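(* Let $(s_n)$ be an almost extremal sequence for $\zeta(s)=1$. Then there exists an almost extremal sequence $(\rho_n)$ for $\zeta'(s)=0$ such that $\lim_n(\rho_n-s_n)=E-\sigma(1)$. Analogously, if $(\rho_n)$ is an almost extremal sequence for $\zeta'(s)=0$, there exists an almost extremal sequence $(s_n)$ for $\zeta(s)=1$ such that $\lim_n(\rho_n-s_n)=E-\sigma(1)$.
   Context: $\zeta$ is the Riemann zeta function. Let $\sigma(1)$ be the supremum of all real $\sigma$ such that $\zeta(\sigma+it)=1$ for some real $t$ (it equals the unique solution $\sigma>1$ of $\zeta(\sigma)=\frac{2^\sigma+1}{2^\sigma-1}$). Let $E$ be the unique solution $\sigma>1$ of $\frac{2^{\sigma+1}}{4^\sigma-1}\log 2=-\frac{\zeta'(\sigma)}{\zeta(\sigma)}$. A sequence of complex numbers $(s_n)$ is almost extremal for $\zeta(s)=1$ if $\zeta(s_n)=1$ for all $n$ and $\lim_n\mathrm{Re}(s_n)=\sigma(1)$. A sequence $(\rho_n)$ is almost extremal for $\zeta'(s)=0$ if $\zeta'(\rho_n)=0$ for all $n$ and $\lim_n\mathrm{Re}(\rho_n)=E$. *)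

(* Defs.v *)
From Stdlib Require Import Reals ClassicalEpsilon.
From Coquelicot Require Import Coquelicot.

Open Scope R_scope.

Definition Cexp (z : C) : C :=
  (exp (Re z) * cos (Im z), exp (Re z) * sin (Im z)).

(* n^s, meaningful for n >= 1. *)
Definition npow (n : nat) (s : C) : C := Cexp (s * RtoC (ln (INR n)))%C.

Definition CSeries (a : nat -> C) : C :=
  (Series (fun n => Re (a n)), Series (fun n => Im (a n))).

Definition dirichlet_zeta (s : C) : C :=
  CSeries (fun n => npow (S n) (- s)%C).

(* Hasse's series
     zeta(s) = 1/(s-1) sum_{n>=0} 1/(n+1) sum_{k=0}^n (-1)^k binom(n,k) (k+1)^(1-s),
   which converges for every complex s and represents the analytic
   continuation of zeta to the plane minus {1}.  The name [C] is taken by the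
   complex numbers, whence the qualified [Binomial.C]. *)
Definition hasse_zeta (s : C) : C :=
  (/ (s - RtoC 1) *
   CSeries (fun n =>
     / RtoC (INR (S n)) *
     sum_n (fun k => RtoC ((-1) ^ k * Binomial.C n k)
                     * npow (S k) (RtoC 1 - s)) n))%C.

(* The Riemann zeta function.  At the pole s = 1 the value is 0, because
   [Cinv 0 = 0], and the function is not differentiable there, so s = 1 is
   neither a solution of zeta(s) = 1 nor of zeta'(s) = 0. *)
Definition zeta (s : C) : C :=
  if Rlt_dec 1 (Re s) then dirichlet_zeta s else hasse_zeta s.

(* sigma(1).  [Lub_Rbar] is the supremum in the extended reals and [real] sends
   infinite values to 0; here the set is nonempty and bounded above. *)
Definition sigma_one : R :=
  real (Lub_Rbar (fun sigma => exists t : R, zeta (sigma, t) = RtoC 1)).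

Definition E_equation (sigma : R) : Prop :=
  1 < sigma /\
  RtoC (Rpower 2 (sigma + 1) / (Rpower 4 sigma - 1) * ln 2)
  = (- (C_derive zeta (RtoC sigma) / zeta (RtoC sigma)))%C.

(* The constant E: the equation has exactly one solution sigma > 1. *)
Definition E_zeta : R := epsilon (inhabits 0) E_equation.

Definition almost_extremal_zeta_one (s : nat -> C) : Prop :=
  (forall n, zeta (s n) = RtoC 1) /\
  is_lim_seq (fun n => Re (s n)) sigma_one.

(* [is_derive] is taken over the field of complex numbers. *)
Definition almost_extremal_zeta'_zero (rho : nat -> C) : Prop :=
  (forall n, is_derive (K := C_AbsRing) (V := C_NormedModule)
               zeta (rho n) (RtoC 0)) /\
  is_lim_seq (fun n => Re (rho n)) E_zeta.

Definition is_lim_Cseq (u : nat -> C) (l : C) : Prop :=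
  filterlim u eventually (locally l).

(* Main.v *)
Require Import Defs.
From Stdlib Require Import Reals Lra Lia Arith List Classical ClassicalEpsilon.
From Coquelicot Require Import Coquelicot.

(** For [Re s > 1] let [Z s], [F s] be the sums of [m^-s] over odd [m >= 1] and of [(2/m)^s] over odd
    [m >= 3].  Since [(1 - 2^-s) zeta s = Z s = 1 + 2^-s F s], the equation [zeta s = 1] says
    [F s = -1].  With [L s] the sum of [Lambda(m) m^-s] over odd [m], one has [Z' = - L Z] and
    [(2^s - 1) zeta' s = - zeta s (K s + ln 2)] with [K = (2^s - 1) L], so that [zeta' s = 0] says
    [K s = - ln 2].  Both are equations [Phi s = - c] for a series [Phi s = sum b_j e^(- l_j s)] with real
    [b_j] and [l_j >= l_0 > 0], and the extremal abscissa is the solution [x0] of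
    [sum |b_j| e^(- l_j x0) = c].  If [Phi (s_n) = - c] and [Re s_n -> x0], all the terms must align in the
    negative direction; conversely, at heights where they align, Newton's method started at [x0]
    yields solutions whose real parts tend to [x0].  For [F] as well as for [K] alignment means that
    [2^(i t) -> -1] and [m^(i t) -> 1] for all odd [m], which transfers solutions from one equation to
    the other.

    That the supremum [sigma(1)] is the solution of [F x0 = 1] needs aligned heights to exist.  Following
    Bohr, let [f t] be the sum of [chi n n^(i t)] over [n <= N], with [chi] completely multiplicative,
    [chi 2 = -1] and [chi m = 1] for odd [m].  The coefficients of [f^q] have the sign [chi n], their
    absolute values add up to [N^q] and at most [(q+1)^N] of them are nonzero; [sup |f|^q] dominates each
    of them, whence [sup |f| = N]. *)

Open Scope R_scope.

(** * Real series *)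

(** The passage from [- zeta' / zeta] to [K] is dictated by the powers of 2. In the sum of
    [Lambda(n) n^-s] over all [n] they contribute [ln 2 / (2^s - 1)], and multiplying by [2^s - 1]
    turns this into the constant [ln 2]. What remains has frequencies [ln (m/2)] with coefficients
    [Lambda(m)] and [ln m] with coefficients [- Lambda(m)], all at least [ln (3/2)]; the opposite
    signs agree exactly where [2^(i t)] is near [-1].

    Two obstacles shape the details. First, [zeta' rho = 0] gives [K rho = - ln 2] only where
    [zeta rho] is nonzero. This is settled by an elementary estimate on [Re s >= 2], which is why
    [E > 2] has to be established numerically. Secondly, an almost extremal sequence is constrained
    only in the limit, so that its first terms may lie outside [Re s > 1]. Arguments about all terms
    are therefore made for the sequence reindexed by [max n N].

    All estimates of a sum by its moduli must have constant 1: the extremal abscissas are defined by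
    equality in the triangle inequality. *)

Lemma is_lim_seq_squeeze_0 (u v : nat -> R) :
  (forall n, Rabs (u n) <= v n) -> is_lim_seq v 0 -> is_lim_seq u 0.
Proof.
  intros H Hv. apply is_lim_seq_abs_0.
  apply (is_lim_seq_le_le (fun _ => 0) _ v).
  - intro n; split; [apply Rabs_pos | apply H].
  - apply is_lim_seq_const.
  - exact Hv.
Qed.

Lemma is_lim_seq_minus_0 (u : nat -> R) (l : R) :
  is_lim_seq (fun n => u n - l) 0 <-> is_lim_seq u l.
Proof.
  split; intro H.
  - apply (is_lim_seq_ext (fun n => (u n - l) + l)); [intro; ring|].
    replace (Finite l) with (Finite (0 + l)) by (f_equal; ring).
    apply is_lim_seq_plus'; [exact H | apply is_lim_seq_const].
  - replace (Finite 0) with (Finite (l - l)) by (f_equal; ring).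
    apply is_lim_seq_minus'; [exact H | apply is_lim_seq_const].
Qed.

Lemma is_lim_seq_sum_f_R0 (u : nat -> nat -> R) (v : nat -> R) (k : nat) :
  (forall d, is_lim_seq (fun n => u n d) (v d)) ->
  is_lim_seq (fun n => sum_f_R0 (u n) k) (sum_f_R0 v k).
Proof.
  intro H; induction k as [|k IH]; simpl; [apply H|].
  apply is_lim_seq_plus'; auto.
Qed.

Lemma is_series_lim (a : nat -> R) (l : R) :
  is_lim_seq (sum_n a) l -> is_series a l.
Proof. intro H; exact H. Qed.

Lemma ex_series_Rle (a b : nat -> R) :
  (forall n, Rabs (a n) <= b n) -> ex_series b -> ex_series a.
Proof. intros H Hb. exact (ex_series_le a b H Hb). Qed.

Lemma Rabs_Series_le (a b : nat -> R) :
  (forall n, Rabs (a n) <= b n) -> ex_series b -> Rabs (Series a) <= Series b.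
Proof.
  intros H Hb.
  assert (ex_series (fun n => Rabs (a n))).
  { apply (ex_series_Rle _ b); auto. intro n; rewrite Rabs_Rabsolu; auto. }
  eapply Rle_trans; [apply Series_Rabs; auto|].
  apply Series_le; auto. intro n; split; [apply Rabs_pos | auto].
Qed.

Lemma sum_n_le_series (a : nat -> R) (l : R) (n : nat) :
  (forall k, 0 <= a k) -> is_series a l -> sum_n a n <= l.
Proof.
  intros Ha Hl.
  apply (is_lim_seq_incr_compare (sum_n a) l Hl).
  intro k; rewrite sum_Sn; unfold plus; simpl; specialize (Ha (S k)); lra.
Qed.

Lemma term_le_series (a : nat -> R) (l : R) (n : nat) :
  (forall k, 0 <= a k) -> is_series a l -> a n <= l.
Proof.
  intros Ha Hl. eapply Rle_trans; [|apply (sum_n_le_series a l n); auto].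
  destruct n as [|n]; [rewrite sum_O; lra|].
  rewrite sum_Sn; unfold plus; simpl.
  assert (0 <= sum_n a n); [|lra].
  rewrite sum_n_Reals. apply cond_pos_sum; auto.
Qed.

Lemma ex_series_bounded (a : nat -> R) (M : R) :
  (forall k, 0 <= a k) -> (forall n, sum_n a n <= M) -> ex_series a.
Proof.
  intros Ha HM.
  destruct (ex_finite_lim_seq_incr (sum_n a) M) as [l Hl]; auto.
  - intro k; rewrite sum_Sn; unfold plus; simpl; specialize (Ha (S k)); lra.
  - exists l. exact Hl.
Qed.

Lemma Series_tail_lim (A : nat -> R) :
  ex_series A -> is_lim_seq (fun n => Series (fun k => A (S n + k)%nat)) 0.
Proof.
  intro HA.
  apply (is_lim_seq_ext (fun n => Series A - sum_n A n)).
  - intro n. rewrite sum_n_Reals.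
    rewrite (Series_incr_n A (S n)); [simpl; lra | lia | auto].
  - replace (Finite 0) with (Finite (Series A - Series A)) by (f_equal; ring).
    apply is_lim_seq_minus'; [apply is_lim_seq_const|].
    apply Series_correct; auto.
Qed.

(** Dominated convergence for series: beyond an index [k] the sum is at most the tail of [A],
    uniformly in [n], and the first terms form a finite sum of null sequences. *)
Lemma tannery_0 (u : nat -> nat -> R) (A : nat -> R) :
  (forall d, is_lim_seq (fun n => u n d) 0) ->
  (forall n d, Rabs (u n d) <= A d) -> ex_series A ->
  is_lim_seq (fun n => Series (u n)) 0.
Proof.
  intros Hl Hu HA.
  apply is_lim_seq_spec; intro eps.
  assert (Ht := Series_tail_lim A HA). apply is_lim_seq_spec in Ht.
  assert (he : 0 < eps / 2) by (destruct eps; simpl; lra).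
  destruct (Ht (mkposreal _ he)) as [k Hk]; cbn [pos] in Hk.
  specialize (Hk k (le_n k)).
  assert (Hs : is_lim_seq (fun n => sum_f_R0 (fun d => Rabs (u n d)) k) 0).
  { replace (Finite 0) with (Finite (sum_f_R0 (fun _ => 0) k)).
    - apply (is_lim_seq_sum_f_R0 (fun n d => Rabs (u n d)) (fun _ => 0)).
      intro d. rewrite <- Rabs_R0.
      apply (is_lim_seq_abs (fun n => u n d) 0). apply Hl.
    - f_equal. clear. induction k; simpl; lra. }
  apply is_lim_seq_spec in Hs.
  destruct (Hs (mkposreal _ he)) as [N HN]; cbn [pos] in HN.
  exists N; intros n Hn. specialize (HN n Hn).
  rewrite Rminus_0_r in *.
  assert (E1 : ex_series (fun d => Rabs (u n d))).
  { apply (ex_series_Rle _ A); auto. intro d; rewrite Rabs_Rabsolu; auto. }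
  assert (E2 : ex_series (fun d => A (S k + d)%nat)).
  { apply ex_series_incr_n; auto. }
  apply Rle_lt_trans with (Series (fun d => Rabs (u n d))).
  { apply Series_Rabs; auto. }
  rewrite (Series_incr_n (fun d => Rabs (u n d)) (S k) ltac:(lia) E1). simpl pred.
  assert (Series (fun d => Rabs (u n (S k + d)%nat)) <= Series (fun d => A (S k + d)%nat)).
  { apply Series_le; auto. intro d; split; [apply Rabs_pos | auto]. }
  apply Rabs_lt_between in Hk. apply Rabs_lt_between in HN.
  cbn [pred] in *. lra.
Qed.

Lemma tannery (u : nat -> nat -> R) (v A : nat -> R) :
  (forall d, is_lim_seq (fun n => u n d) (v d)) ->
  (forall n d, Rabs (u n d) <= A d) -> ex_series A ->
  is_lim_seq (fun n => Series (u n)) (Series v).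
Proof.
  intros Hl Hu HA.
  assert (Hv : forall d, Rabs (v d) <= A d).
  { intro d. apply (is_lim_seq_le (fun n => Rabs (u n d)) (fun _ => A d) (Rabs (v d)) (A d)).
    - auto.
    - apply (is_lim_seq_abs (fun n => u n d) (v d)); auto.
    - apply is_lim_seq_const. }
  apply is_lim_seq_minus_0.
  apply (is_lim_seq_ext (fun n => Series (fun d => u n d - v d))).
  { intro n. apply Series_minus; apply (ex_series_Rle _ A); auto. }
  apply (tannery_0 (fun n d => u n d - v d) (fun d => 2 * A d)).
  - intro d. apply is_lim_seq_minus_0. apply Hl.
  - intros n d. unfold Rminus. eapply Rle_trans; [apply Rabs_triang|].
    rewrite Rabs_Ropp. specialize (Hu n d); specialize (Hv d); lra.
  - apply (ex_series_scal_l 2 A HA).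
Qed.

Lemma sum_n_Series (c : nat -> nat -> R) (N : nat) :
  (forall n, ex_series (c n)) ->
  ex_series (fun d => sum_n (fun n => c n d) N) /\
  sum_n (fun n => Series (c n)) N = Series (fun d => sum_n (fun n => c n d) N).
Proof.
  intro H; induction N as [|N [IH1 IH2]].
  - split.
    + apply (ex_series_ext (c 0%nat)); auto. intro d; rewrite sum_O; auto.
    + rewrite sum_O. apply Series_ext. intro d; rewrite sum_O; auto.
  - split.
    + apply (ex_series_ext (fun d => sum_n (fun n => c n d) N + c (S N) d)).
      * intro d; rewrite sum_Sn; auto.
      * exact (ex_series_plus _ _ IH1 (H (S N))).
    + rewrite sum_Sn, IH2. unfold plus; simpl.
      rewrite <- Series_plus; auto.
      apply Series_ext. intro d; rewrite sum_Sn; auto.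
Qed.

(** Tannery's theorem applied to the partial sums in [n], which are dominated by [A d] for all [N]
    at once. *)
Lemma series_swap (c : nat -> nat -> R) (A : nat -> R) :
  (forall n d, Rabs (c n d) <= A d) ->
  (forall d N, Rabs (sum_n (fun n => c n d) N) <= A d) ->
  (forall d, ex_series (fun n => c n d)) -> ex_series A ->
  is_series (fun n => Series (c n)) (Series (fun d => Series (fun n => c n d))).
Proof.
  intros H1 H2 H3 HA.
  assert (E : forall n, ex_series (c n)).
  { intro n; apply (ex_series_Rle _ A); auto. }
  apply is_series_lim, (is_lim_seq_ext (fun N => Series (fun d => sum_n (fun n => c n d) N))).
  { intro N. symmetry. apply sum_n_Series; auto. }
  apply (tannery (fun N d => sum_n (fun n => c n d) N) _ A); auto.
  intro d. exact (Series_correct _ (H3 d)).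
Qed.

(** The partial sums of [u] are constant between consecutive values of [phi]. The intended [phi]
    enumerates the multiples of an odd integer. *)
Lemma is_series_subseq (phi : nat -> nat) (u : nat -> R) (l : R) :
  (forall k, (phi k < phi (S k))%nat) ->
  (forall j, (forall k, j <> phi k) -> u j = 0) ->
  is_series u l -> is_series (fun k => u (phi k)) l.
Proof.
  intros Hphi Hu Hl.
  assert (Hmono : forall a b, (a < b)%nat -> (phi a < phi b)%nat).
  { intros a b Hab. induction Hab; [apply Hphi|]. specialize (Hphi m); lia. }
  assert (Hbet : forall k j, (phi k < j < phi (S k))%nat -> u j = 0).
  { intros k j Hj. apply Hu. intros k' ->.
    destruct (Nat.lt_trichotomy k k') as [h|[->|h]].
    - destruct (Nat.eq_dec k' (S k)) as [->|]; [lia|].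
      assert (phi (S k) < phi k')%nat by (apply Hmono; lia). lia.
    - lia.
    - apply Hmono in h. lia. }
  assert (Hs : forall k, sum_n (fun k => u (phi k)) k = sum_n u (phi k)).
  { induction k as [|k IH].
    - rewrite sum_O.
      assert (forall j, (j < phi 0%nat)%nat -> sum_n u j = 0).
      { assert (Hz : forall j, (j < phi 0%nat)%nat -> u j = 0).
        { intros j Hj. apply Hu. intros k ->. destruct k; [lia|].
          assert (phi 0%nat < phi (S k))%nat by (apply Hmono; lia). lia. }
        induction j; intro Hj; [rewrite sum_O; auto|].
        rewrite sum_Sn, IHj, Hz; try lia. unfold plus; simpl; lra. }
      destruct (phi 0%nat) as [|m] eqn:E0; [rewrite sum_O; auto|].
      rewrite (sum_Sn u m), (H m) by lia. unfold plus; simpl; lra.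
    - rewrite sum_Sn, IH.
      assert (forall m, (phi k <= m < phi (S k))%nat -> sum_n u m = sum_n u (phi k)).
      { induction m; intro Hm.
        - replace (phi k) with 0%nat by lia; auto.
        - destruct (Nat.eq_dec (phi k) (S m)) as [->|]; auto.
          rewrite sum_Sn, IHm, (Hbet k (S m)) by lia. unfold plus; simpl; lra. }
      specialize (Hphi k). destruct (phi (S k)) as [|m] eqn:E0; [lia|].
      rewrite (sum_Sn u m), (H m) by lia. auto. }
  apply is_series_lim. apply (is_lim_seq_ext (fun k => sum_n u (phi k))); [auto|].
  apply (is_lim_seq_subseq (sum_n u) l phi); auto.
  apply eventually_subseq; auto.
Qed.

Lemma sum_n_pairs (u : nat -> R) (k : nat) :
  sum_n (fun m => u (2 * m)%nat + u (S (2 * m))) k = sum_n u (S (2 * k)).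
Proof.
  induction k as [|k IH].
  - rewrite sum_O. change (S (2 * 0)) with 1%nat. rewrite sum_Sn, sum_O. auto.
  - rewrite sum_Sn, IH. replace (2 * S k)%nat with (S (S (2 * k))) by lia.
    rewrite (sum_Sn u (S (S (2 * k)))), (sum_Sn u (S (2 * k))).
    unfold plus; simpl; lra.
Qed.

Lemma is_series_pairs (u : nat -> R) (l : R) :
  is_series u l -> is_series (fun m => u (2 * m)%nat + u (S (2 * m))) l.
Proof.
  intro Hl.
  apply is_series_lim. apply (is_lim_seq_ext (fun k => sum_n u (S (2 * k)))).
  { intro k. symmetry. apply sum_n_pairs. }
  apply (is_lim_seq_subseq (sum_n u) l (fun k => S (2 * k))); auto.
  apply eventually_subseq; intro; lia.
Qed.

Lemma is_series_finite (u : nat -> R) (N : nat) :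
  (forall n, (N < n)%nat -> u n = 0) -> is_series u (sum_n u N).
Proof.
  intro H. apply is_series_lim, (is_lim_seq_ext_loc (fun _ => sum_n u N)).
  - exists N. intros n Hn. induction Hn; auto.
    rewrite sum_Sn, <- IHHn, H by lia. unfold plus; simpl; lra.
  - apply is_lim_seq_const.
Qed.

(** * Complex exponential and complex series *)

Lemma exp_le_exp (x y : R) : x <= y -> exp x <= exp y.
Proof. intros [H| ->]; [left; apply exp_increasing; auto | lra]. Qed.

Lemma Cexp_plus (z w : C) : Cexp (z + w)%C = (Cexp z * Cexp w)%C.
Proof.
  destruct z as [a b], w as [c d]. unfold Cexp, Cplus, Cmult; simpl.
  rewrite exp_plus, cos_plus, sin_plus. f_equal; ring.
Qed.

Lemma Cmod_Cexp (z : C) : Cmod (Cexp z) = exp (Re z).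
Proof.
  unfold Cmod, Cexp; simpl.
  replace (_ + _) with (exp (Re z) ^ 2 * ((sin (Im z))² + (cos (Im z))²)).
  - rewrite sin2_cos2, Rmult_1_r. apply sqrt_pow2. left; apply exp_pos.
  - unfold Rsqr; ring.
Qed.

Lemma Cmod_le_Re_Im (z : C) : Cmod z <= Rabs (Re z) + Rabs (Im z).
Proof.
  unfold Cmod. destruct z as [a b]; simpl fst; simpl snd; unfold Re, Im; simpl fst; simpl snd.
  rewrite <- (sqrt_pow2 (Rabs a + Rabs b)).
  - apply sqrt_le_1_alt. rewrite <- (pow2_abs a), <- (pow2_abs b).
    assert (h := Rabs_pos a). assert (h' := Rabs_pos b). nra.
  - assert (h := Rabs_pos a). assert (h' := Rabs_pos b). lra.
Qed.

Lemma Re_le_Cmod (z : C) : Rabs (Re z) <= Cmod z.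
Proof. eapply Rle_trans; [apply Rmax_l | apply Rmax_Cmod]. Qed.

Lemma Im_le_Cmod (z : C) : Rabs (Im z) <= Cmod z.
Proof. eapply Rle_trans; [apply Rmax_r | apply Rmax_Cmod]. Qed.

Lemma unit_interval_MVT (f df : R -> R) (B : R) :
  (forall x, 0 <= x <= 1 -> is_derive f x (df x)) ->
  (forall x, 0 <= x <= 1 -> Rabs (df x) <= B) ->
  Rabs (f 1 - f 0) <= B.
Proof.
  intros Hd HB.
  destruct (MVT_gen f 0 1 df) as [c [Hc ->]].
  - intros x Hx. rewrite Rmin_left, Rmax_right in Hx by lra. apply Hd; lra.
  - intros x Hx. rewrite Rmin_left, Rmax_right in Hx by lra.
    apply continuity_pt_filterlim. apply (ex_derive_continuous f x).
    eexists; apply Hd; lra.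
  - rewrite Rmin_left, Rmax_right in Hc by lra.
    rewrite Rminus_0_r, Rmult_1_r. auto.
Qed.

Section ExpSegment.
Variables b d : C.

Let seg (t : R) : C := (b + RtoC t * d)%C.

Lemma is_derive_Re_Cexp_segment (t : R) :
  is_derive (fun t => Re (Cexp (seg t))) t (Re (Cexp (seg t) * d)%C).
Proof.
  destruct b as [b1 b2], d as [d1 d2].
  unfold seg, Cexp, Re, Im, Cmult, Cplus; simpl.
  auto_derive; [auto | unfold Rminus; ring].
Qed.

Lemma is_derive_Im_Cexp_segment (t : R) :
  is_derive (fun t => Im (Cexp (seg t))) t (Im (Cexp (seg t) * d)%C).
Proof.
  destruct b as [b1 b2], d as [d1 d2].
  unfold seg, Cexp, Re, Im, Cmult, Cplus; simpl.
  auto_derive; [auto | unfold Rminus; ring].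
Qed.

(** The mean value inequality along a segment, applied to the real and imaginary parts separately;
    hence the factor 2. The constant [k] is free: [k = 0] gives a Lipschitz bound, [k = Cexp c] a
    linearization. *)
Lemma Cexp_segment_bound (k : C) (B : R) :
  (forall t, 0 <= t <= 1 -> Cmod ((Cexp (seg t) - k) * d)%C <= B) ->
  Cmod (Cexp (b + d) - Cexp b - k * d)%C <= 2 * B.
Proof.
  intro HB.
  assert (h1 : seg 1 = (b + d)%C).
  { unfold seg. rewrite Cmult_1_l; auto. }
  assert (h0 : seg 0 = b).
  { unfold seg. rewrite Cmult_0_l, Cplus_0_r; auto. }
  rewrite <- h1. rewrite <- h0 at 1.
  eapply Rle_trans; [apply Cmod_le_Re_Im|].
  assert (HR : Rabs (Re (Cexp (seg 1) - Cexp (seg 0) - k * d)%C) <= B).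
  { replace (Re _) with
      ((Re (Cexp (seg 1)) - 1 * Re (k * d)%C) - (Re (Cexp (seg 0)) - 0 * Re (k * d)%C))
      by (unfold Re, Cminus, Cplus, Copp; simpl; ring).
    apply (unit_interval_MVT (fun t => Re (Cexp (seg t)) - t * Re (k * d)%C)
             (fun t => Re ((Cexp (seg t) - k) * d)%C)).
    - intros t _. evar_last.
      + apply (is_derive_minus (fun t => Re (Cexp (seg t))) (fun t => t * Re (k * d)%C)).
        * apply is_derive_Re_Cexp_segment.
        * apply (is_derive_mult (fun t => t) (fun _ => Re (k * d)%C));
            [apply is_derive_id | apply (is_derive_const (Re (k*d)%C)) | intros; apply Rmult_comm].
      + unfold minus, plus, opp, mult, one, zero, Re, Cminus, Cplus, Copp, Cmult; simpl. ring.
    - intros t Ht. eapply Rle_trans; [apply Re_le_Cmod | auto]. }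
  assert (HI : Rabs (Im (Cexp (seg 1) - Cexp (seg 0) - k * d)%C) <= B).
  { replace (Im _) with
      ((Im (Cexp (seg 1)) - 1 * Im (k * d)%C) - (Im (Cexp (seg 0)) - 0 * Im (k * d)%C))
      by (unfold Im, Cminus, Cplus, Copp; simpl; ring).
    apply (unit_interval_MVT (fun t => Im (Cexp (seg t)) - t * Im (k * d)%C)
             (fun t => Im ((Cexp (seg t) - k) * d)%C)).
    - intros t _. evar_last.
      + apply (is_derive_minus (fun t => Im (Cexp (seg t))) (fun t => t * Im (k * d)%C)).
        * apply is_derive_Im_Cexp_segment.
        * apply (is_derive_mult (fun t => t) (fun _ => Im (k * d)%C));
            [apply is_derive_id | apply (is_derive_const (Im (k*d)%C)) | intros; apply Rmult_comm].
      + unfold minus, plus, opp, mult, one, zero, Im, Cminus, Cplus, Copp, Cmult; simpl. ring.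
    - intros t Ht. eapply Rle_trans; [apply Im_le_Cmod | auto]. }
  lra.
Qed.

End ExpSegment.

Lemma Re_segment_le (b d : C) (t M : R) :
  0 <= t <= 1 -> Re b <= M -> Re (b + d)%C <= M -> Re (b + RtoC t * d)%C <= M.
Proof.
  destruct b as [b1 b2], d as [d1 d2]; unfold Re; simpl. intros. nra.
Qed.

Lemma Cexp_lipschitz (a b : C) (M : R) :
  Re a <= M -> Re b <= M -> Cmod (Cexp a - Cexp b)%C <= 2 * (Cmod (a - b)%C * exp M).
Proof.
  intros Ha Hb.
  assert (e : (b + (a - b))%C = a) by ring.
  replace (Cexp a - Cexp b)%C with (Cexp (b + (a - b)) - Cexp b - RtoC 0 * (a - b))%C
    by (rewrite e; ring).
  apply Cexp_segment_bound. intros t Ht.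
  rewrite Cmod_mult, Rmult_comm. apply Rmult_le_compat_l; [apply Cmod_ge_0|].
  replace (_ - RtoC 0)%C with (Cexp (b + RtoC t * (a - b)))%C by ring.
  rewrite Cmod_Cexp. apply exp_le_exp. apply Re_segment_le; auto. rewrite e; auto.
Qed.

(** The slope is taken at a third point [c], because Newton's method below compares two points near
    a fixed centre. With [c = b] the bound is the usual quadratic remainder. *)
Lemma Cexp_taylor (a b c : C) (M R : R) :
  Re a <= M -> Re b <= M -> Re c <= M ->
  Cmod (a - c)%C <= R -> Cmod (b - c)%C <= R ->
  Cmod (Cexp a - Cexp b - Cexp c * (a - b))%C <= 4 * R * Cmod (a - b)%C * exp M.
Proof.
  intros Ha Hb Hc HaR HbR.
  assert (e : (b + (a - b))%C = a) by ring.
  rewrite <- e at 1.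
  replace (4 * R * Cmod (a - b)%C * exp M) with (2 * ((2 * (R * exp M)) * Cmod (a - b)%C)) by ring.
  apply Cexp_segment_bound. intros t Ht.
  rewrite Cmod_mult. apply Rmult_le_compat_r; [apply Cmod_ge_0|].
  eapply Rle_trans; [apply (Cexp_lipschitz _ _ M); auto|].
  { apply Re_segment_le; auto. rewrite e; auto. }
  apply Rmult_le_compat_l; [lra|]. apply Rmult_le_compat_r; [left; apply exp_pos|].
  replace (b + RtoC t * (a - b) - c)%C with (RtoC t * (a - c) + RtoC (1 - t) * (b - c))%C
    by (rewrite RtoC_minus; ring).
  eapply Rle_trans; [apply Cmod_triangle|].
  rewrite !Cmod_mult, !Cmod_R, !Rabs_pos_eq by lra. nra.
Qed.

Definition is_csum (a : nat -> C) (l : C) : Prop :=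
  is_series (fun n => Re (a n)) (Re l) /\ is_series (fun n => Im (a n)) (Im l).

Lemma is_csum_CSeries (a : nat -> C) (l : C) : is_csum a l -> CSeries a = l.
Proof.
  intros [H1 H2]. unfold CSeries.
  rewrite (is_series_unique _ _ H1), (is_series_unique _ _ H2).
  destruct l; auto.
Qed.

Lemma is_csum_ext (a b : nat -> C) (l : C) :
  (forall n, a n = b n) -> is_csum a l -> is_csum b l.
Proof.
  intros H [H1 H2]; split; [eapply is_series_ext; [|exact H1] | eapply is_series_ext; [|exact H2]];
    intro n; simpl; rewrite H; auto.
Qed.

Lemma is_csum_plus (a b : nat -> C) (la lb : C) :
  is_csum a la -> is_csum b lb -> is_csum (fun n => a n + b n)%C (la + lb)%C.
Proof.
  intros [H1 H2] [H3 H4]; split.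
  - exact (is_series_plus _ _ _ _ H1 H3).
  - exact (is_series_plus _ _ _ _ H2 H4).
Qed.

Lemma is_csum_scal (k : C) (a : nat -> C) (l : C) :
  is_csum a l -> is_csum (fun n => k * a n)%C (k * l)%C.
Proof.
  intros [H1 H2]. destruct k as [x y].
  assert (h := fun c => is_series_scal_l (K := R_AbsRing) (V := R_NormedModule) c _ _ H1).
  assert (h' := fun c => is_series_scal_l (K := R_AbsRing) (V := R_NormedModule) c _ _ H2).
  split.
  - exact (is_series_minus _ _ _ _ (h x) (h' y)).
  - exact (is_series_plus _ _ _ _ (h' x) (h y)).
Qed.

Lemma is_csum_minus (a b : nat -> C) (la lb : C) :
  is_csum a la -> is_csum b lb -> is_csum (fun n => a n - b n)%C (la - lb)%C.
Proof.
  intros H1 H2.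
  replace (la - lb)%C with (la + (RtoC (-1)) * lb)%C by ring.
  apply (is_csum_ext (fun n => a n + (RtoC (-1)) * b n)%C); [intro; ring|].
  apply is_csum_plus; auto. apply is_csum_scal; auto.
Qed.

Lemma CSeries_correct (a : nat -> C) (b : nat -> R) :
  (forall n, Cmod (a n) <= b n) -> ex_series b -> is_csum a (CSeries a).
Proof.
  intros H Hb; split; apply Series_correct; apply (ex_series_Rle _ b); auto;
    intro n; (eapply Rle_trans; [|apply H]).
  - apply Re_le_Cmod.
  - apply Im_le_Cmod.
Qed.

(** Multiplication by [Cconj l] turns the sum onto the positive real axis, where only real parts
    count. This yields constant 1, which a bound by real and imaginary parts would lose. *)
Lemma Cmod_csum_le (a : nat -> C) (b : nat -> R) (l : C) :
  (forall n, Cmod (a n) <= b n) -> ex_series b -> is_csum a l -> Cmod l <= Series b.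
Proof.
  intros H Hb Hl.
  destruct (Req_dec (Cmod l) 0) as [E|E].
  { rewrite E. assert (h := Rabs_Series_le (fun _ => 0) b).
    eapply Rle_trans; [apply Rabs_pos|]. apply h; auto.
    intro n. rewrite Rabs_R0. eapply Rle_trans; [apply Cmod_ge_0 | apply H]. }
  assert (Hp : 0 < Cmod l) by (assert (h := Cmod_ge_0 l); lra).
  apply Rmult_le_reg_l with (Cmod l); auto.
  assert (Hc := proj1 (is_csum_scal (Cconj l) a l Hl)). cbv beta in Hc.
  assert (Hm : Re (Cconj l * l)%C = Cmod l * Cmod l).
  { transitivity (Cmod l ^ 2); [|ring].
    unfold Cmod. rewrite pow2_sqrt.
    - destruct l; unfold Re; simpl; ring.
    - destruct l; simpl; nra. }
  rewrite <- Hm, <- (is_series_unique _ _ Hc), <- (Series_scal_l (Cmod l) b).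
  eapply Rle_trans; [apply Rle_abs|]. apply Rabs_Series_le.
  - intro n. eapply Rle_trans; [apply Re_le_Cmod|].
    rewrite Cmod_mult, Cmod_conj. apply Rmult_le_compat_l; auto. lra.
  - exact (ex_series_scal_l (Cmod l) b Hb).
Qed.

Lemma is_csum_pairs (u : nat -> C) (l : C) :
  is_csum u l -> is_csum (fun m => u (2 * m)%nat + u (S (2 * m)))%C l.
Proof.
  intros [H1 H2]; split.
  - exact (is_series_pairs _ _ H1).
  - exact (is_series_pairs _ _ H2).
Qed.

Lemma is_csum_subseq (phi : nat -> nat) (u : nat -> C) (l : C) :
  (forall k, (phi k < phi (S k))%nat) ->
  (forall j, (forall k, j <> phi k) -> u j = RtoC 0) ->
  is_csum u l -> is_csum (fun k => u (phi k)) l.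
Proof.
  intros Hp Hu [H1 H2]; split.
  - apply (is_series_subseq phi (fun n => Re (u n))); auto.
    intros j Hj; rewrite Hu; auto.
  - apply (is_series_subseq phi (fun n => Im (u n))); auto.
    intros j Hj; rewrite Hu; auto.
Qed.

(** * Generalized Dirichlet series *)

Lemma Cmod_lim_seq_0 (u : nat -> C) :
  is_lim_seq (fun n => Re (u n)) 0 -> is_lim_seq (fun n => Im (u n)) 0 ->
  is_lim_seq (fun n => Cmod (u n)) 0.
Proof.
  intros HR HI.
  apply (is_lim_seq_squeeze_0 _ (fun n => Rabs (Re (u n)) + Rabs (Im (u n)))).
  - intro n. rewrite (Rabs_pos_eq (Cmod _)) by apply Cmod_ge_0. apply Cmod_le_Re_Im.
  - replace (Finite 0) with (Finite (0 + 0)) by (f_equal; ring).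
    apply is_lim_seq_plus'; apply -> is_lim_seq_abs_0; auto.
Qed.

(** Banach's theorem on a closed ball. The [k]-th iterate stays within [2 d (1 - 2^-k)] of [x0],
    where [d <= r / 2] is the length of the first step, so the iteration never leaves the ball. *)
Lemma contraction_fixed_point (T : C -> C) (x0 : C) (r : R) :
  (forall z w, Cmod (z - x0)%C <= r -> Cmod (w - x0)%C <= r ->
     Cmod (T z - T w)%C <= / 2 * Cmod (z - w)%C) ->
  Cmod (T x0 - x0)%C <= r / 2 ->
  exists z, T z = z /\ Cmod (z - x0)%C <= 2 * Cmod (T x0 - x0)%C.
Proof.
  intros HT Hr. set (d := Cmod (T x0 - x0)%C) in *.
  assert (d0 : 0 <= d) by apply Cmod_ge_0.
  pose (x := fix x (k : nat) : C := match k with O => x0 | S k => T (x k) end).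
  assert (Hq : forall k, 0 < (/ 2) ^ k) by (intro k; apply pow_lt; lra).
  assert (Hx : forall k, Cmod (x (S k) - x k)%C <= d * (/ 2) ^ k /\
                         Cmod (x k - x0)%C <= 2 * d * (1 - (/ 2) ^ k)).
  { induction k as [|k [IH1 IH2]].
    - simpl. split; [fold d; lra|].
      replace (x0 - x0)%C with (RtoC 0) by ring. rewrite Cmod_0; lra.
    - assert (IH3 : Cmod (x (S k) - x0)%C <= 2 * d * (1 - (/ 2) ^ S k)).
      { replace (x (S k) - x0)%C with ((x (S k) - x k) + (x k - x0))%C by ring.
        eapply Rle_trans; [apply Cmod_triangle|]. simpl pow. lra. }
      split; auto.
      change (x (S (S k))) with (T (x (S k))). change (x (S k)) with (T (x k)) at 2.
      eapply Rle_trans; [apply HT|].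
      + eapply Rle_trans; [apply IH3|]. assert (h := Hq (S k)). nra.
      + eapply Rle_trans; [apply IH2|]. assert (h := Hq k). nra.
      + simpl pow. lra. }
  (* Completeness enters through the telescoping series of increments: the limit is [x0] plus its
     sum. *)
  assert (Hb : is_series (fun k => d * (/ 2) ^ k) (2 * d)).
  { replace (2 * d) with (d * / (1 - / 2)) by field.
    apply (is_series_scal_l d (fun k => (/ 2) ^ k) (/ (1 - / 2))).
    apply is_series_geom. rewrite Rabs_pos_eq; lra. }
  assert (Hs := CSeries_correct (fun k => x (S k) - x k)%C _ (fun k => proj1 (Hx k)) (ex_intro _ _ Hb)).
  set (L := CSeries _) in Hs.
  assert (HL := Cmod_csum_le _ _ _ (fun k => proj1 (Hx k)) (ex_intro _ _ Hb) Hs).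
  rewrite (is_series_unique _ _ Hb) in HL.
  set (z := (x0 + L)%C).
  assert (Hz : Cmod (z - x0)%C <= 2 * d).
  { replace (z - x0)%C with L by (unfold z; ring). auto. }
  assert (Hlim : is_lim_seq (fun k => Cmod (z - x (S k))%C) 0).
  { assert (h1 : forall k, sum_n (fun n => Re (x (S n) - x n)%C) k = Re (x (S k)) - Re x0).
    { induction k; [rewrite sum_O; reflexivity|]. rewrite sum_Sn, IHk.
      unfold plus, Re, Cminus, Cplus, Copp; simpl; ring. }
    assert (h2 : forall k, sum_n (fun n => Im (x (S n) - x n)%C) k = Im (x (S k)) - Im x0).
    { induction k; [rewrite sum_O; reflexivity|]. rewrite sum_Sn, IHk.
      unfold plus, Im, Cminus, Cplus, Copp; simpl; ring. }
    destruct Hs as [Hs1 Hs2].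
    apply Cmod_lim_seq_0.
    - apply (is_lim_seq_ext (fun k => Re L - sum_n (fun n => Re (x (S n) - x n)%C) k)).
      + intro k. rewrite h1. unfold z, Re, Cminus, Cplus, Copp; simpl; ring.
      + replace (Finite 0) with (Finite (Re L - Re L)) by (f_equal; ring).
        apply is_lim_seq_minus'; [apply is_lim_seq_const | exact Hs1].
    - apply (is_lim_seq_ext (fun k => Im L - sum_n (fun n => Im (x (S n) - x n)%C) k)).
      + intro k. rewrite h2. unfold z, Im, Cminus, Cplus, Copp; simpl; ring.
      + replace (Finite 0) with (Finite (Im L - Im L)) by (f_equal; ring).
        apply is_lim_seq_minus'; [apply is_lim_seq_const | exact Hs2]. }
  exists z. split; auto.
  assert (Hle : Cmod (T z - z)%C <= 0).
  { apply (is_lim_seq_le (fun _ => Cmod (T z - z)%C)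
      (fun k => / 2 * Cmod (z - x (S k))%C + Cmod (z - x (S (S k)))%C) (Cmod (T z - z)%C) 0).
    - intro k.
      replace (T z - z)%C with ((T z - T (x (S k))) + - (z - x (S (S k))))%C by (simpl; ring).
      eapply Rle_trans; [apply Cmod_triangle|]. rewrite Cmod_opp.
      apply Rplus_le_compat_r. apply HT; [lra|].
      eapply Rle_trans; [apply Hx|]. assert (h := Hq (S k)). nra.
    - apply is_lim_seq_const.
    - replace (Finite 0) with (Finite (/ 2 * 0 + 0)) by (f_equal; ring).
      apply is_lim_seq_plus'.
      + apply (is_lim_seq_scal_l _ (/ 2) 0). exact Hlim.
      + apply (is_lim_seq_incr_1 (fun k => Cmod (z - x (S k))%C)). exact Hlim. }
  assert (h : (T z - z)%C = RtoC 0) by (apply Cmod_eq_0; assert (h := Cmod_ge_0 (T z - z)%C); lra).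
  replace (T z) with ((T z - z) + z)%C by ring. rewrite h; ring.
Qed.

Definition gterm (b lam : nat -> R) (s : C) (j : nat) : C :=
  (RtoC (b j) * Cexp (- (RtoC (lam j) * s)))%C.

Definition gdir (b lam : nat -> R) (s : C) : C := CSeries (gterm b lam s).

Definition gabs (b lam : nat -> R) (x : R) : R :=
  Series (fun j => Rabs (b j) * exp (- (lam j * x))).

Record gdir_ok (b lam : nat -> R) : Prop := {
  gdir_lam_pos : forall j, 0 <= lam j;
  gdir_conv : forall x, 1 < x -> ex_series (fun j => Rabs (b j) * exp (- (lam j * x))) }.

Lemma Re_gterm (b lam : nat -> R) (x t : R) (j : nat) :
  Re (gterm b lam (x, t) j) = b j * cos (lam j * t) * exp (- (lam j * x)).
Proof.
  unfold gterm, Cexp, Re, Im, Cmult, Copp; simpl.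
  replace (- (lam j * t + 0 * x)) with (- (lam j * t)) by ring.
  rewrite cos_neg.
  replace (- (lam j * x - 0 * t)) with (- (lam j * x)) by ring. ring.
Qed.

Lemma Im_gterm (b lam : nat -> R) (x t : R) (j : nat) :
  Im (gterm b lam (x, t) j) = - (b j * sin (lam j * t) * exp (- (lam j * x))).
Proof.
  unfold gterm, Cexp, Re, Im, Cmult, Copp; simpl.
  replace (- (lam j * t + 0 * x)) with (- (lam j * t)) by ring.
  rewrite sin_neg.
  replace (- (lam j * x - 0 * t)) with (- (lam j * x)) by ring. ring.
Qed.

Lemma Cmod_gterm (b lam : nat -> R) (s : C) (j : nat) :
  Cmod (gterm b lam s j) = Rabs (b j) * exp (- (lam j * Re s)).
Proof.
  unfold gterm. rewrite Cmod_mult, Cmod_R, Cmod_Cexp. do 2 f_equal.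
  destruct s; unfold Re; simpl; ring.
Qed.

Section GeneralizedDirichlet.

Variables b lam : nat -> R.
Hypothesis Hok : gdir_ok b lam.

Let lam_pos := gdir_lam_pos b lam Hok.
Let conv := gdir_conv b lam Hok.

Lemma gdir_correct (s : C) : 1 < Re s -> is_csum (gterm b lam s) (gdir b lam s).
Proof.
  intro Hs. apply (CSeries_correct _ (fun j => Rabs (b j) * exp (- (lam j * Re s)))).
  - intro j; rewrite Cmod_gterm; lra.
  - apply conv; auto.
Qed.

Lemma Cmod_gdir_le (s : C) : 1 < Re s -> Cmod (gdir b lam s) <= gabs b lam (Re s).
Proof.
  intro Hs. apply (Cmod_csum_le (gterm b lam s)).
  - intro j; rewrite Cmod_gterm; lra.
  - apply conv; auto.
  - apply gdir_correct; auto.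
Qed.

(** Half of the margin [x - 1] pays for the factor [lam j]: [lam <= exp (lam * eta) / eta], and the
    series still converges at [x - eta > 1]. *)
Lemma gdir_ok_deriv : gdir_ok (fun j => b j * lam j) lam.
Proof.
  split; auto. intros x Hx. set (eta := (x - 1) / 2).
  assert (He : 0 < eta) by (unfold eta; lra).
  apply (ex_series_Rle _ (fun j => / eta * (Rabs (b j) * exp (- (lam j * (x - eta)))))).
  - intro j. rewrite (Rabs_mult (b j)), (Rabs_pos_eq (lam j)) by auto.
    assert (h0 := lam_pos j). assert (hb := Rabs_pos (b j)).
    rewrite (Rabs_pos_eq (_ * _ * _)).
    2:{ apply Rmult_le_pos; [apply Rmult_le_pos; auto | left; apply exp_pos]. }
    replace (- (lam j * (x - eta))) with (lam j * eta + - (lam j * x)) by ring.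
    rewrite exp_plus.
    assert (hp := exp_pos (- (lam j * x))).
    assert (h : lam j <= / eta * exp (lam j * eta)).
    { apply Rmult_le_reg_l with eta; auto. rewrite <- Rmult_assoc, Rinv_r, Rmult_1_l by lra.
      assert (h := exp_ineq1_le (lam j * eta)). lra. }
    replace (Rabs (b j) * lam j * exp (- (lam j * x))) with
      ((Rabs (b j) * exp (- (lam j * x))) * lam j) by ring.
    replace (/ eta * (Rabs (b j) * (exp (lam j * eta) * exp (- (lam j * x))))) with
      ((Rabs (b j) * exp (- (lam j * x))) * (/ eta * exp (lam j * eta))) by ring.
    apply Rmult_le_compat_l; auto. apply Rmult_le_pos; lra.
  - apply (ex_series_scal_l (/ eta) (fun j => Rabs (b j) * exp (- (lam j * (x - eta))))).
    apply conv. unfold eta; lra.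
Qed.

End GeneralizedDirichlet.

(** The third series is minus the derivative at [c], hence the plus sign. The bound serves twice:
    for the contraction in Newton's method, and with [w = c] for complex differentiability. *)
Lemma gdir_increment (b lam : nat -> R) (z w c : C) (x r : R) :
  gdir_ok b lam -> 1 < x -> x <= Re z -> x <= Re w -> x <= Re c ->
  Cmod (z - c)%C <= r -> Cmod (w - c)%C <= r ->
  Cmod (gdir b lam z - gdir b lam w + gdir (fun j => (b j * lam j)%R) lam c * (z - w))%C
  <= 4 * r * Cmod (z - w)%C * gabs (fun j => b j * lam j * lam j) lam x.
Proof.
  intros Hok Hx Hz Hw Hc Hzr Hwr.
  assert (Hok1 := gdir_ok_deriv _ _ Hok). assert (Hok2 := gdir_ok_deriv _ _ Hok1).
  assert (S1 : is_csum (fun j => gterm b lam z j - gterm b lam w j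
                 + (z - w) * gterm (fun j => (b j * lam j)%R) lam c j)%C
               (gdir b lam z - gdir b lam w + (z - w) * gdir (fun j => (b j * lam j)%R) lam c)%C).
  { apply is_csum_plus; [apply is_csum_minus | apply is_csum_scal]; apply gdir_correct; auto; lra. }
  rewrite (Cmult_comm (gdir _ lam c)).
  unfold gabs. rewrite <- Series_scal_l.
  apply (Cmod_csum_le _ _ _) with (3 := S1).
  - intro j. assert (h0 := gdir_lam_pos _ _ Hok j).
    replace (_ + _)%C with (RtoC (b j) * (Cexp (- (RtoC (lam j) * z)) - Cexp (- (RtoC (lam j) * w))
       - Cexp (- (RtoC (lam j) * c)) * (- (RtoC (lam j) * z) - - (RtoC (lam j) * w))))%C
      by (unfold gterm; rewrite RtoC_mult; ring).
    rewrite Cmod_mult, Cmod_R, !Rabs_mult, (Rabs_pos_eq (lam j)) by auto.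
    assert (Hexp : forall u : C, x <= Re u -> Re (- (RtoC (lam j) * u))%C <= - (lam j * x)).
    { intros [u1 u2]; unfold Re; simpl; nra. }
    assert (Hmod : forall u v : C, Cmod (- (RtoC (lam j) * u) - - (RtoC (lam j) * v))%C
                                   = lam j * Cmod (u - v)%C).
    { intros u v. replace (_ - _)%C with (- (RtoC (lam j) * (u - v)))%C by ring.
      rewrite Cmod_opp, Cmod_mult, Cmod_R, Rabs_pos_eq; auto. }
    assert (h := Cexp_taylor (- (RtoC (lam j) * z))%C (- (RtoC (lam j) * w))%C
       (- (RtoC (lam j) * c))%C (- (lam j * x)) (lam j * r) (Hexp _ Hz) (Hexp _ Hw) (Hexp _ Hc)).
    rewrite !Hmod in h.
    apply Rle_trans with (Rabs (b j) * (4 * (lam j * r) * (lam j * Cmod (z - w)%C) * exp (- (lam j * x)))).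
    + apply Rmult_le_compat_l; [apply Rabs_pos|]. apply h; apply Rmult_le_compat_l; auto.
    + right; ring.
  - apply (ex_series_scal_l (4 * r * Cmod (z - w)%C) (fun j => Rabs (b j * lam j * lam j) * exp (- (lam j * x)))).
    apply (gdir_conv _ _ Hok2); auto.
Qed.

(** * Sums of moduli as functions of the abscissa *)

Lemma gabs_lipschitz (b lam : nat -> R) (x y x0 : R) :
  gdir_ok b lam -> 1 < x0 -> x0 <= x -> x0 <= y ->
  Rabs (gabs b lam x - gabs b lam y)
  <= 2 * gabs (fun j => b j * lam j) lam x0 * Rabs (x - y).
Proof.
  intros Hok H0 Hx Hy. unfold gabs.
  rewrite <- Series_minus by (apply (gdir_conv _ _ Hok); lra).
  rewrite (Rmult_assoc 2), (Rmult_comm (Series _)), <- Rmult_assoc, <- Series_scal_l.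
  apply Rabs_Series_le.
  - intro j. assert (h0 := gdir_lam_pos _ _ Hok j).
    rewrite <- Rmult_minus_distr_l, Rabs_mult, Rabs_Rabsolu, Rabs_mult, (Rabs_pos_eq (lam j)) by auto.
    replace (2 * Rabs (x - y) * (Rabs (b j) * lam j * exp (- (lam j * x0)))) with
      (Rabs (b j) * (2 * ((lam j * Rabs (x - y)) * exp (- (lam j * x0))))) by ring.
    apply Rmult_le_compat_l; [apply Rabs_pos|].
    assert (h := Cexp_lipschitz (RtoC (- (lam j * x))) (RtoC (- (lam j * y))) (- (lam j * x0))).
    assert (E : forall u, Cexp (RtoC u) = RtoC (exp u)).
    { intro u. unfold Cexp, RtoC, Re, Im; simpl. rewrite cos_0, sin_0. f_equal; ring. }
    rewrite !E, <- !RtoC_minus, !Cmod_R in h. unfold Re, RtoC in h; simpl in h.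
    replace (- (lam j * x) - - (lam j * y)) with (- (lam j * (x - y))) in h by ring.
    rewrite Rabs_Ropp, Rabs_mult, (Rabs_pos_eq (lam j)) in h by auto.
    apply h; nra.
  - apply (ex_series_scal_l (2 * Rabs (x - y)) (fun j => Rabs (b j * lam j) * exp (- (lam j * x0)))).
    apply (gdir_conv _ _ (gdir_ok_deriv _ _ Hok)); auto.
Qed.

Lemma gabs_ge_0 (b lam : nat -> R) (x : R) : gdir_ok b lam -> 1 < x -> 0 <= gabs b lam x.
Proof.
  intros Hok Hx. unfold gabs.
  apply Rle_trans with (Rabs (b 0%nat) * exp (- (lam 0%nat * x))).
  - apply Rmult_le_pos; [apply Rabs_pos | left; apply exp_pos].
  - apply (term_le_series (fun j => Rabs (b j) * exp (- (lam j * x)))).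
    + intro k; apply Rmult_le_pos; [apply Rabs_pos | left; apply exp_pos].
    + apply Series_correct. apply (gdir_conv _ _ Hok); auto.
Qed.

Lemma gabs_seq_continuous (b lam : nat -> R) (x : nat -> R) (x0 : R) :
  gdir_ok b lam -> 1 < x0 -> (forall n, 1 < x n) -> is_lim_seq x x0 ->
  is_lim_seq (fun n => gabs b lam (x n)) (gabs b lam x0).
Proof.
  intros Hok H0 Hx Hl.
  set (x1 := (1 + x0) / 2).
  destruct (proj2 (is_lim_seq_spec _ _) Hl (mkposreal (x0 - x1) ltac:(unfold x1; lra))) as [N HN].
  cbn [pos] in HN.
  apply is_lim_seq_minus_0.
  apply (is_lim_seq_incr_n _ N).
  apply (is_lim_seq_squeeze_0 _ (fun n => 2 * gabs (fun j => b j * lam j) lam x1 * Rabs (x (n + N)%nat - x0))).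
  - intro n. apply gabs_lipschitz; auto; unfold x1 in *; try lra.
    specialize (HN (n + N)%nat ltac:(lia)). apply Rabs_lt_between in HN. lra.
  - replace (Finite 0) with (Rbar_mult (2 * gabs (fun j => b j * lam j) lam x1) 0) by (simpl; f_equal; ring).
    apply is_lim_seq_scal_l. apply -> is_lim_seq_abs_0.
    apply (is_lim_seq_incr_n (fun n => x n - x0) N). apply is_lim_seq_minus_0; auto.
Qed.

(** A positive lower bound [l0] on the frequencies yields both strict monotonicity and decay to 0,
    hence existence of the extremal abscissa. *)
Lemma gabs_decay (b lam : nat -> R) (l0 x h : R) :
  gdir_ok b lam -> (forall j, l0 <= lam j) -> 1 < x -> 0 <= h ->
  gabs b lam (x + h) <= exp (- (l0 * h)) * gabs b lam x.
Proof.
  intros Hok Hl Hx Hh. unfold gabs. rewrite <- Series_scal_l.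
  apply Series_le.
  - intro j; split.
    + apply Rmult_le_pos; [apply Rabs_pos | left; apply exp_pos].
    + replace (- (lam j * (x + h))) with (- (lam j * h) + - (lam j * x)) by ring.
      rewrite exp_plus.
      replace (exp (- (l0 * h)) * (Rabs (b j) * exp (- (lam j * x))))
        with (Rabs (b j) * (exp (- (l0 * h)) * exp (- (lam j * x)))) by ring.
      apply Rmult_le_compat_l; [apply Rabs_pos|].
      apply Rmult_le_compat_r; [left; apply exp_pos|].
      apply exp_le_exp. specialize (Hl j). nra.
  - apply (ex_series_scal_l (exp (- (l0 * h))) (fun j => Rabs (b j) * exp (- (lam j * x)))).
    apply (gdir_conv _ _ Hok); auto.
Qed.

Lemma gabs_strict_decr (b lam : nat -> R) (l0 x y : R) :
  gdir_ok b lam -> 0 < l0 -> (forall j, l0 <= lam j) -> 1 < x -> x < y ->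
  0 < gabs b lam x -> gabs b lam y < gabs b lam x.
Proof.
  intros Hok H0 Hl Hx Hy Hp.
  replace y with (x + (y - x)) by ring.
  eapply Rle_lt_trans; [apply (gabs_decay _ _ l0); auto; lra|].
  rewrite <- (Rmult_1_l (gabs b lam x)) at 2.
  apply Rmult_lt_compat_r; auto. rewrite <- exp_0. apply exp_increasing. nra.
Qed.

Lemma gabs_solution (b lam : nat -> R) (l0 x c : R) :
  gdir_ok b lam -> 0 < l0 -> (forall j, l0 <= lam j) -> 1 < x -> 0 < c -> c < gabs b lam x ->
  exists y, x <= y /\ gabs b lam y = c.
Proof.
  intros Hok H0 Hl Hx Hc Hgt.
  (* With [g = gabs b lam x] this choice makes the decay factor [exp (- g / c)], and [exp u >= u]
     gives [g * exp (- g / c) <= c]. *)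
  set (h := gabs b lam x / (c * l0)).
  assert (hh : 0 <= h).
  { unfold h. apply Rmult_le_pos; [lra|]. left; apply Rinv_0_lt_compat; nra. }
  assert (Hle : gabs b lam (x + h) <= c).
  { eapply Rle_trans; [apply (gabs_decay _ _ l0); auto|].
    replace (l0 * h) with (gabs b lam x / c) by (unfold h; field; lra).
    rewrite exp_Ropp. apply Rmult_le_reg_l with (exp (gabs b lam x / c)); [apply exp_pos|].
    rewrite <- Rmult_assoc, Rinv_r, Rmult_1_l by (assert (hp := exp_pos (gabs b lam x / c)); lra).
    assert (he := exp_ineq1_le (gabs b lam x / c)).
    apply Rle_trans with (gabs b lam x / c * c); [right; field; lra|].
    apply Rmult_le_compat_r; lra. }
  (* Freezing the function to the left of [x] gives a globally Lipschitz function, as [IVT_gen] asks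
     for continuity on the whole line. *)
  set (f := fun u => gabs b lam (Rmax x u)).
  set (M := gabs (fun j => b j * lam j) lam x).
  assert (HM : 0 <= M) by (apply gabs_ge_0; auto; apply gdir_ok_deriv; auto).
  assert (Hf : forall u v, Rabs (f u - f v) <= 2 * M * Rabs (u - v)).
  { intros u v. eapply Rle_trans; [apply (gabs_lipschitz _ _ _ _ x); auto; apply Rmax_l|].
    fold M. apply Rmult_le_compat_l; [lra|].
    unfold Rmax; destruct (Rle_dec x u), (Rle_dec x v); unfold Rabs; repeat destruct (Rcase_abs _); lra. }
  assert (Hcont : Ranalysis1.continuity f).
  { intros u eps Heps. exists (eps / (2 * M + 1)). split.
    - apply Rmult_lt_0_compat; [lra|]. apply Rinv_0_lt_compat; lra.
    - intros v [_ Hv]. simpl in *. unfold Rdist in *.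
      eapply Rle_lt_trans; [apply Hf|].
      apply Rle_lt_trans with ((2 * M + 1) * Rabs (v - u)).
      + assert (hp := Rabs_pos (v - u)). nra.
      + apply Rmult_lt_reg_l with (/ (2 * M + 1)); [apply Rinv_0_lt_compat; lra|].
        rewrite <- Rmult_assoc, Rinv_l, Rmult_1_l by lra. rewrite Rmult_comm. exact Hv. }
  destruct (IVT_gen f x (x + h) c Hcont) as [y [Hy1 Hy2]].
  - unfold f. rewrite (Rmax_left x x), (Rmax_right x (x + h)) by lra.
    rewrite Rmin_right, Rmax_left by lra. lra.
  - rewrite Rmin_left, Rmax_right in Hy1 by lra.
    exists y; split; [lra|]. unfold f in Hy2. rewrite Rmax_right in Hy2; lra.
Qed.

(** * Alignment of the terms at a sequence of heights *)

Definition aligned (b lam t : nat -> R) : Prop :=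
  forall j, is_lim_seq (fun n => b j * cos (lam j * t n)) (- Rabs (b j)).

(* The value [-c] has the largest possible modulus in the limit, so every term must point in the
   negative real direction. *)
Lemma aligned_of_solutions (b lam : nat -> R) (s : nat -> C) (x0 c : R) :
  gdir_ok b lam -> 1 < x0 -> gabs b lam x0 = c ->
  (forall n, 1 < Re (s n)) -> (forall n, gdir b lam (s n) = RtoC (- c)) ->
  is_lim_seq (fun n => Re (s n)) x0 ->
  aligned b lam (fun n => Im (s n)).
Proof.
  intros Hok H0 Hc Hs1 Hs Hl j.
  assert (Hlim := gabs_seq_continuous b lam _ _ Hok H0 Hs1 Hl). rewrite Hc in Hlim.
  (* The real parts of the terms sum to [- c]. Adding the moduli gives a series of nonnegative terms
     with sum [gabs b lam (Re (s n)) - c], which tends to 0 and bounds each of them. *)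
  assert (Hterm : forall n, Rabs ((b j * cos (lam j * Im (s n)) + Rabs (b j)) * exp (- (lam j * Re (s n))))
                            <= gabs b lam (Re (s n)) - c).
  { intro n.
    assert (Hser := proj1 (gdir_correct b lam Hok (s n) (Hs1 n))). rewrite Hs in Hser.
    assert (Hab := Series_correct _ (gdir_conv _ _ Hok (Re (s n)) (Hs1 n))).
    assert (Hsum := is_series_plus _ _ _ _ Hab Hser).
    change (is_series (fun k => Rabs (b k) * exp (- (lam k * Re (s n))) + Re (gterm b lam (s n) k))
              (gabs b lam (Re (s n)) + - c)) in Hsum.
    assert (Hg : forall k, Re (gterm b lam (s n) k)
                   = b k * cos (lam k * Im (s n)) * exp (- (lam k * Re (s n)))).
    { intro k. rewrite <- Re_gterm. destruct (s n); auto. }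
    assert (Hpos : forall k, 0 <= (b k * cos (lam k * Im (s n)) + Rabs (b k)) * exp (- (lam k * Re (s n)))).
    { intro k. apply Rmult_le_pos; [|left; apply exp_pos].
      assert (hc := COS_bound (lam k * Im (s n))).
      unfold Rabs; destruct (Rcase_abs (b k)); nra. }
    rewrite Rabs_pos_eq by auto.
    apply (term_le_series (fun k => (b k * cos (lam k * Im (s n)) + Rabs (b k)) * exp (- (lam k * Re (s n)))));
      auto.
    eapply is_series_ext; [|exact Hsum]. intro k; cbv beta. rewrite Hg. apply Rminus_diag_uniq; ring. }
  apply is_lim_seq_minus_0.
  apply (is_lim_seq_ext (fun n => (b j * cos (lam j * Im (s n)) + Rabs (b j)) * exp (- (lam j * Re (s n)))
                                   * exp (lam j * Re (s n)))).
  { intro n. rewrite Rmult_assoc, <- exp_plus.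
    replace (- (lam j * Re (s n)) + lam j * Re (s n)) with 0 by ring. rewrite exp_0. ring. }
  replace (Finite 0) with (Finite (0 * exp (lam j * x0))) by (f_equal; ring).
  apply is_lim_seq_mult'.
  - eapply is_lim_seq_squeeze_0; [exact Hterm|]. apply is_lim_seq_minus_0; auto.
  - apply (is_lim_seq_continuous exp (fun n => lam j * Re (s n)) (lam j * x0)).
    + apply derivable_continuous, derivable_exp.
    + apply (is_lim_seq_scal_l _ (lam j) x0). auto.
Qed.

(** Alignment prescribes only cosines, but the prescribed limit is extreme:
    [(b sin)^2 = b^2 - (b cos)^2] tends to 0. *)
Lemma aligned_sin (b lam t : nat -> R) (j : nat) :
  aligned b lam t -> is_lim_seq (fun n => b j * sin (lam j * t n)) 0.
Proof.
  intro H. specialize (H j).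
  assert (Hsq : is_lim_seq (fun n => (b j * sin (lam j * t n)) * (b j * sin (lam j * t n))) 0).
  { apply (is_lim_seq_ext (fun n => b j * b j - (b j * cos (lam j * t n)) * (b j * cos (lam j * t n)))).
    - intro n. assert (h := sin2_cos2 (lam j * t n)). unfold Rsqr in h.
      replace (b j * b j) with (b j * b j * (sin (lam j * t n) * sin (lam j * t n)
        + cos (lam j * t n) * cos (lam j * t n))) at 1 by (rewrite h; ring). ring.
    - replace (Finite 0) with (Finite (b j * b j - (- Rabs (b j)) * (- Rabs (b j)))).
      + apply is_lim_seq_minus'; [apply is_lim_seq_const | apply is_lim_seq_mult'; auto].
      + f_equal. unfold Rabs; destruct (Rcase_abs (b j)); ring. }
  apply is_lim_seq_abs_0.
  apply (is_lim_seq_ext (fun n => sqrt ((b j * sin (lam j * t n)) * (b j * sin (lam j * t n))))).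
  { intro n. apply sqrt_Rsqr_abs. }
  rewrite <- sqrt_0.
  apply (is_lim_seq_continuous sqrt _ 0); auto. apply continuity_pt_sqrt; lra.
Qed.

(** Termwise limits pass to the sum by Tannery's theorem, the dominating series being the one that
    defines [gabs b lam x0]. *)
Lemma gdir_aligned_lim (b lam t : nat -> R) (x0 : R) :
  gdir_ok b lam -> 1 < x0 -> aligned b lam t ->
  is_lim_seq (fun n => Cmod (gdir b lam (x0, t n) + RtoC (gabs b lam x0))%C) 0.
Proof.
  intros Hok H0 Hal.
  assert (Hconv := gdir_conv _ _ Hok x0 H0).
  assert (He : forall j, Rabs (exp (- (lam j * x0))) = exp (- (lam j * x0))).
  { intro j. apply Rabs_pos_eq. left; apply exp_pos. }
  assert (Hbd : forall (u : R) j, Rabs u <= 1 ->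
            Rabs (b j * u * exp (- (lam j * x0))) <= Rabs (b j) * exp (- (lam j * x0))).
  { intros u j Hu. rewrite !Rabs_mult, He. apply Rmult_le_compat_r; [left; apply exp_pos|].
    assert (hb := Rabs_pos (b j)). nra. }
  apply Cmod_lim_seq_0.
  - apply (is_lim_seq_ext (fun n => Series (fun j => b j * cos (lam j * t n) * exp (- (lam j * x0)))
                                     - (- gabs b lam x0))).
    { intro n. change (Re (gdir b lam (x0, t n) + RtoC (gabs b lam x0))%C)
        with (Series (fun j => Re (gterm b lam (x0, t n) j)) + gabs b lam x0).
      rewrite (Series_ext (fun j => Re (gterm b lam (x0, t n) j)) _ (Re_gterm b lam x0 (t n))). ring. }
    apply is_lim_seq_minus_0.
    unfold gabs. rewrite <- Series_opp.
    apply (tannery _ _ (fun j => Rabs (b j) * exp (- (lam j * x0)))); auto.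
    + intro j. replace (- (Rabs (b j) * exp (- (lam j * x0)))) with (- Rabs (b j) * exp (- (lam j * x0))) by ring.
      apply is_lim_seq_mult'; [apply Hal | apply is_lim_seq_const].
    + intros n j. apply Hbd. apply Rabs_le. apply COS_bound.
  - apply (is_lim_seq_ext (fun n => Series (fun j => - (b j * sin (lam j * t n) * exp (- (lam j * x0)))))).
    { intro n. change (Im (gdir b lam (x0, t n) + RtoC (gabs b lam x0))%C)
        with (Series (fun j => Im (gterm b lam (x0, t n) j)) + 0).
      rewrite (Series_ext (fun j => Im (gterm b lam (x0, t n) j)) _ (Im_gterm b lam x0 (t n))). ring. }
    apply (tannery_0 _ (fun j => Rabs (b j) * exp (- (lam j * x0)))); auto.
    + intro j. replace (Finite 0) with (Finite (- (0 * exp (- (lam j * x0))))) by (f_equal; ring).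
      apply (is_lim_seq_opp _ (Finite (0 * exp (- (lam j * x0))))).
      apply is_lim_seq_mult'; [apply aligned_sin; auto | apply is_lim_seq_const].
    + intros n j. rewrite Rabs_Ropp. apply Hbd. apply Rabs_le. apply SIN_bound.
Qed.

Lemma aligned_scal (b lam t : nat -> R) :
  (forall j, 0 <= lam j) -> aligned b lam t -> aligned (fun j => b j * lam j) lam t.
Proof.
  intros Hl H j.
  apply (is_lim_seq_ext (fun n => lam j * (b j * cos (lam j * t n)))); [intro; ring|].
  replace (- Rabs (b j * lam j)) with (lam j * - Rabs (b j)).
  - apply (is_lim_seq_scal_l _ (lam j) (- Rabs (b j))). apply H.
  - rewrite Rabs_mult, (Rabs_pos_eq (lam j)) by auto. ring.
Qed.

(* Newton's method at [x0 + i t n]: the derivative there tends to [gabs (b lam) lam x0], which is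
   nonzero. *)
Lemma solutions_of_aligned (b lam t : nat -> R) (l0 x0 c : R) :
  gdir_ok b lam -> 0 < l0 -> (forall j, l0 <= lam j) -> 1 < x0 -> 0 < c ->
  gabs b lam x0 = c -> aligned b lam t ->
  exists (z : nat -> C) (N : nat),
    (forall n, (N <= n)%nat -> gdir b lam (z n + (0, t n))%C = RtoC (- c)) /\
    is_lim_seq (fun n => Cmod (z n - RtoC x0)%C) 0.
Proof.
  intros Hok H0 Hl Hx0 Hc Hg Hal.
  assert (Hok1 := gdir_ok_deriv _ _ Hok). assert (Hok2 := gdir_ok_deriv _ _ Hok1).
  set (D := gabs (fun j => b j * lam j) lam x0).
  (* Termwise [lam j >= l0], so [D >= l0 * c]. *)
  assert (HD : 0 < D).
  { apply Rlt_le_trans with (l0 * c); [nra|]. rewrite <- Hg. unfold D, gabs.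
    rewrite <- Series_scal_l. apply Series_le; [|apply (gdir_conv _ _ Hok1); auto].
    intro j. assert (hb := Rabs_pos (b j)). assert (he := exp_pos (- (lam j * x0))).
    specialize (Hl j). rewrite Rabs_mult, (Rabs_pos_eq (lam j)) by lra.
    split.
    - apply Rmult_le_pos; [lra|]. apply Rmult_le_pos; lra.
    - replace (l0 * (Rabs (b j) * exp (- (lam j * x0)))) with
        (Rabs (b j) * exp (- (lam j * x0)) * l0) by ring.
      replace (Rabs (b j) * lam j * exp (- (lam j * x0))) with
        (Rabs (b j) * exp (- (lam j * x0)) * lam j) by ring.
      apply Rmult_le_compat_l; auto. apply Rmult_le_pos; lra. }
  set (x1 := (1 + x0) / 2).
  set (M := gabs (fun j => b j * lam j * lam j) lam x1).
  assert (HM : 0 <= M) by (apply gabs_ge_0; auto; unfold x1; lra).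
  (* The first bound keeps the ball in [Re >= x1 > 1], where [M] controls second derivatives; the
     second makes the error [4 * r * M] of the linearization at most [D / 4]. *)
  set (r := Rmin (x0 - x1) (D / (16 * (M + 1)))).
  assert (Hr : 0 < r).
  { apply Rmin_glb_lt; [unfold x1; lra|]. apply Rmult_lt_0_compat; auto.
    apply Rinv_0_lt_compat; lra. }
  assert (Hr1 : r <= x0 - x1) by apply Rmin_l.
  assert (Hr2 : 4 * r * M <= D / 4).
  { assert (r <= D / (16 * (M + 1))) by apply Rmin_r.
    apply Rle_trans with (4 * (D / (16 * (M + 1))) * (M + 1)); [|right; field; lra].
    assert (0 < D / (16 * (M + 1))) by lra. nra. }
  set (Dn := fun n => gdir (fun j => b j * lam j) lam (x0, t n)).
  assert (L1 := gdir_aligned_lim _ _ _ x0 Hok Hx0 Hal). rewrite Hg in L1.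
  assert (L2 := gdir_aligned_lim _ _ _ x0 Hok1 Hx0
                 (aligned_scal _ _ _ (gdir_lam_pos _ _ Hok) Hal)). fold D in L2.
  destruct (proj2 (is_lim_seq_spec _ _) L1 (mkposreal (D * r / 2) ltac:(nra))) as [N1 HN1].
  destruct (proj2 (is_lim_seq_spec _ _) L2 (mkposreal (D / 4) ltac:(lra))) as [N2 HN2].
  cbn [pos] in HN1, HN2.
  assert (Hmod : forall w : C, Cmod (w / RtoC D)%C = Cmod w / D).
  { intro w. rewrite Cmod_div, Cmod_R, Rabs_pos_eq; auto; [lra|].
    intro h; apply RtoC_inj in h; lra. }
  assert (HDC : RtoC D <> RtoC 0) by (intro h; apply RtoC_inj in h; lra).
  assert (Key : forall n, (max N1 N2 <= n)%nat -> exists z : C,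
     gdir b lam (z + (0, t n))%C = RtoC (- c) /\
     Cmod (z - RtoC x0)%C <= 2 / D * Cmod (gdir b lam (x0, t n) + RtoC c)%C).
  { intros n Hn.
    specialize (HN1 n ltac:(lia)). specialize (HN2 n ltac:(lia)).
    rewrite Rminus_0_r, Rabs_pos_eq in HN1, HN2 by apply Cmod_ge_0.
    (* Newton's map with the derivative replaced by its limit [D]. Since [Dn n] is minus the
       derivative, it is [Dn n + RtoC D] that is small. *)
    set (T := fun z : C => (z - (gdir b lam (z + (0, t n)) + RtoC c) / RtoC D)%C).
    assert (e0 : (RtoC x0 + (0, t n))%C = (x0, t n)).
    { unfold Cplus, RtoC; simpl. f_equal; ring. }
    assert (ET : (T (RtoC x0) - RtoC x0)%C = (- ((gdir b lam (x0, t n) + RtoC c) / RtoC D))%C).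
    { unfold T. rewrite e0. ring. }
    destruct (contraction_fixed_point T (RtoC x0) r) as [z [Hz1 Hz2]].
    - intros z w Hz Hw.
      assert (Hre : forall u : C, Cmod (u - RtoC x0)%C <= r -> x1 <= Re (u + (0, t n))%C).
      { intros u Hu. assert (h := Re_le_Cmod (u - RtoC x0)%C).
        assert (h1 : Rabs (Re u - x0) <= r) by (unfold Re in *; simpl in *; eapply Rle_trans; eauto).
        apply Rabs_le_between in h1. destruct u; unfold Re in *; simpl in *; lra. }
      assert (Hsub : forall u v : C, (u + (0, t n) - (v + (0, t n)))%C = (u - v)%C) by (intros; ring).
      assert (HI := gdir_increment b lam (z + (0, t n))%C (w + (0, t n))%C (RtoC x0 + (0, t n))%C x1 r Hok).
      rewrite !Hsub, e0 in HI. fold M in HI. fold (Dn n) in HI.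
      assert (Hx1 : x1 <= Re (x0, t n)) by (unfold Re, x1; simpl; lra).
      specialize (HI ltac:(unfold x1; lra) (Hre _ Hz) (Hre _ Hw) Hx1 Hz Hw).
      set (G := (gdir b lam (z + (0, t n)) - gdir b lam (w + (0, t n)) + Dn n * (z - w))%C) in HI.
      replace (T z - T w)%C with ((((Dn n + RtoC D) * (z - w)) - G) / RtoC D)%C
        by (unfold T, G; field; auto).
      rewrite Hmod. apply Rmult_le_reg_r with D; auto. unfold Rdiv.
      rewrite (Rmult_assoc (Cmod _)), Rinv_l, Rmult_1_r by lra.
      unfold Cminus at 1. eapply Rle_trans; [apply Cmod_triangle|].
      rewrite Cmod_opp, Cmod_mult. fold (Dn n) in HN2.
      assert (hp := Cmod_ge_0 (z - w)%C). nra.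
    - rewrite ET, Cmod_opp, Hmod.
      apply Rmult_le_reg_r with D; auto. unfold Rdiv. rewrite Rmult_assoc, Rinv_l by lra. lra.
    - exists z; split.
      + assert (h : ((gdir b lam (z + (0, t n)) + RtoC c) / RtoC D)%C = RtoC 0).
        { replace (_ / _)%C with (z - T z)%C by (unfold T; ring). rewrite Hz1; ring. }
        replace (gdir b lam (z + (0, t n))%C) with
          (((gdir b lam (z + (0, t n)) + RtoC c) / RtoC D) * RtoC D - RtoC c)%C by (field; auto).
        rewrite h, RtoC_opp. ring.
      + rewrite ET, Cmod_opp, Hmod in Hz2. eapply Rle_trans; [exact Hz2|]. right; field; lra. }
  destruct (choice (fun n z => (max N1 N2 <= n)%nat ->
     gdir b lam (z + (0, t n))%C = RtoC (- c) /\
     Cmod (z - RtoC x0)%C <= 2 / D * Cmod (gdir b lam (x0, t n) + RtoC c)%C)) as [z Hz].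
  { intro n. destruct (le_lt_dec (max N1 N2) n) as [h|h].
    - destruct (Key n h) as [z Hz]. exists z; auto.
    - exists (RtoC 0). intro; lia. }
  exists z, (max N1 N2). split; [intros n Hn; apply Hz; auto|].
  apply (is_lim_seq_incr_n _ (max N1 N2)).
  apply (is_lim_seq_squeeze_0 _ (fun n => 2 / D * Cmod (gdir b lam (x0, t (n + max N1 N2)%nat) + RtoC c)%C)).
  - intro n. rewrite Rabs_pos_eq by apply Cmod_ge_0. apply Hz; lia.
  - replace (Finite 0) with (Rbar_mult (2 / D) 0) by (simpl; f_equal; ring).
    apply is_lim_seq_scal_l.
    apply (is_lim_seq_incr_n (fun n => Cmod (gdir b lam (x0, t n) + RtoC c)%C)). exact L1.
Qed.

(** * Simultaneous approximation *)

Definition antiperiodic (h : R -> R) : Prop := exists tau, forall t, h (t + tau) = - h t.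

Definition rsum {A : Type} (f : A -> R) (l : list A) : R :=
  fold_right (fun a s => f a + s) 0 l.

(* Averaging over a half-period of one summand removes it and keeps the constant term, the upper
   bound and the antiperiodicity of the other summands. *)
Lemma antiperiodic_sum_sup (n : nat) (l : list (R -> R)) (c S : R) :
  length l = n -> (forall h, In h l -> antiperiodic h) ->
  (forall t, c + rsum (fun h => h t) l <= S) -> c <= S.
Proof.
  revert l. induction n as [|n IH]; intros l Hn Hl HS.
  - destruct l; [|discriminate]. specialize (HS 0). simpl in HS. lra.
  - destruct l as [|h l]; [discriminate|].
    destruct (Hl h (or_introl eq_refl)) as [tau Htau].
    apply (IH (map (fun k => fun t => (k t + k (t + tau)) / 2) l)).
    + rewrite length_map. simpl in Hn; lia.
    + intros k Hk. apply in_map_iff in Hk. destruct Hk as [k0 [<- Hk0]].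
      destruct (Hl k0 (or_intror Hk0)) as [s Hs].
      exists s. intro t. replace (t + s + tau) with (t + tau + s) by ring. rewrite !Hs. field.
    + intro t.
      assert (E : rsum (fun k => k t) (map (fun k => fun t => (k t + k (t + tau)) / 2) l)
              = (rsum (fun k => k t) l + rsum (fun k => k (t + tau)) l) / 2).
      { clear. induction l as [|k l IH]; simpl; [lra|]. rewrite IH. lra. }
      rewrite E. assert (h1 := HS t). assert (h2 := HS (t + tau)).
      simpl in h1, h2. rewrite Htau in h2. lra.
Qed.

Section Bohr.

Variable chi : nat -> R.
Hypothesis chi_1 : chi 1%nat = 1.
Hypothesis chi_mul : forall m n, (0 < m)%nat -> (0 < n)%nat -> chi (m * n)%nat = chi m * chi n.
Hypothesis chi_sq : forall n, chi n * chi n = 1.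

Let e (t : R) (n : nat) : C := (RtoC (chi n) * Cexp (0, (t * ln (INR n))%R))%C.

Let esum (t : R) (l : list nat) : C := fold_right (fun n s => (e t n + s)%C) (RtoC 0) l.

Lemma e_mul (t : R) (m n : nat) : (0 < m)%nat -> (0 < n)%nat -> e t (m * n) = (e t m * e t n)%C.
Proof.
  intros Hm Hn. unfold e. rewrite chi_mul, mult_INR, ln_mult by (auto; apply lt_0_INR; auto).
  replace (0, (t * (ln (INR m) + ln (INR n)))%R) with
    ((0, (t * ln (INR m))%R) + (0, (t * ln (INR n))%R))%C
    by (unfold Cplus; simpl; f_equal; ring).
  rewrite Cexp_plus, RtoC_mult. ring.
Qed.

Lemma Cmod_e (t : R) (n : nat) : Cmod (e t n) = 1.
Proof.
  unfold e. rewrite Cmod_mult, Cmod_R, Cmod_Cexp. unfold Re; simpl. rewrite exp_0, Rmult_1_r.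
  assert (h := chi_sq n). unfold Rabs; destruct (Rcase_abs (chi n)); nra.
Qed.

Lemma esum_app (t : R) (l l' : list nat) : esum t (l ++ l') = (esum t l + esum t l')%C.
Proof. induction l as [|n l IH]; simpl; [ring|]. rewrite IH. ring. Qed.

Lemma Cmod_esum_le (t : R) (l : list nat) : Cmod (esum t l) <= INR (length l).
Proof.
  induction l as [|n l IH]; [simpl; rewrite Cmod_0; lra|].
  change (length (n :: l)) with (S (length l)). rewrite S_INR.
  simpl. eapply Rle_trans; [apply Cmod_triangle|]. rewrite Cmod_e. lra.
Qed.

Let count (v : nat) (l : list nat) : nat := length (filter (Nat.eqb v) l).

Lemma e_conj_e (t : R) (v w : nat) :
  Re (Cconj (e t v) * e t w)%C = chi v * chi w * cos (t * (ln (INR w) - ln (INR v))).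
Proof.
  unfold e, Cexp, Cconj, Cmult, Re, Im, RtoC; simpl. rewrite exp_0.
  rewrite (Rmult_minus_distr_l t (ln (INR w)) (ln (INR v))), cos_minus. ring.
Qed.

(** A Fourier coefficient is at most the supremum. After multiplication by the conjugate of [e t v],
    the occurrences of [v] contribute the constant [count v l], and every other [w] a cosine of
    nonzero frequency [ln w - ln v], which changes sign under a shift by half a period. *)
Lemma count_le_sup (l : list nat) (v : nat) (S : R) :
  (forall w, In w l -> (0 < w)%nat) -> (0 < v)%nat ->
  (forall t, Cmod (esum t l) <= S) -> INR (count v l) <= S.
Proof.
  intros Hl Hv HS.
  set (h := fun w t => chi v * chi w * cos (t * (ln (INR w) - ln (INR v)))).
  apply (antiperiodic_sum_sup _ (map h (filter (fun w => negb (v =? w)) l)) _ _ eq_refl).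
  - intros k Hk. apply in_map_iff in Hk. destruct Hk as [w [<- Hw]].
    apply filter_In in Hw. destruct Hw as [Hw Hne].
    apply Bool.negb_true_iff, Nat.eqb_neq in Hne.
    assert (Hd : ln (INR w) - ln (INR v) <> 0).
    { intro E0. apply Hne. apply INR_eq. apply ln_inv; try (apply lt_0_INR; auto). lra. }
    exists (PI / (ln (INR w) - ln (INR v))). intro t. unfold h.
    replace ((t + PI / (ln (INR w) - ln (INR v))) * (ln (INR w) - ln (INR v)))
      with (t * (ln (INR w) - ln (INR v)) + PI) by (field; auto).
    rewrite neg_cos. ring.
  - intro t. eapply Rle_trans; [|apply (HS t)].
    apply Rle_trans with (Re (Cconj (e t v) * esum t l)%C).
    + right. clear HS. induction l as [|w l IH].
      * simpl. unfold count; simpl. ring.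
      * assert (IH' := IH (fun x Hx => Hl x (or_intror Hx))). clear IH.
        change (esum t (w :: l)) with (e t w + esum t l)%C.
        replace (Re (Cconj (e t v) * (e t w + esum t l))%C) with
          (Re (Cconj (e t v) * e t w)%C + Re (Cconj (e t v) * esum t l)%C)
          by (unfold Re, Cmult, Cplus; simpl; ring).
        rewrite e_conj_e, <- IH'. unfold count. simpl filter.
        destruct (Nat.eqb_spec v w) as [->|Hne].
        -- simpl negb. cbv iota. change (length (w :: filter (Nat.eqb w) l))
             with (Datatypes.S (length (filter (Nat.eqb w) l))).
           rewrite S_INR, chi_sq, Rminus_diag, Rmult_0_r, cos_0. ring.
        -- simpl negb. cbv iota. cbn [map]. unfold rsum at 1. cbn [fold_right].
           fold (rsum (fun k : R -> R => k t) (map h (filter (fun w => negb (v =? w)) l))).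
           unfold h at 1. ring.
    + eapply Rle_trans; [apply Rle_abs|]. eapply Rle_trans; [apply Re_le_Cmod|].
      rewrite Cmod_mult, Cmod_conj, Cmod_e. lra.
Qed.

Lemma pigeonhole_count (B l : list nat) (M : nat) :
  (forall w, In w l -> In w B) -> (forall v, In v l -> (count v l <= M)%nat) ->
  (length l <= length B * M)%nat.
Proof.
  revert l. induction B as [|x B IH]; intros l HB HM.
  - destruct l as [|w l]; [simpl; lia|]. destruct (HB w (or_introl eq_refl)).
  - rewrite <- (filter_length (Nat.eqb x) l).
    assert (h1 : (length (filter (Nat.eqb x) l) <= M)%nat).
    { destruct (filter (Nat.eqb x) l) as [|y k] eqn:E0; [simpl; lia|].
      assert (Hy : In y (filter (Nat.eqb x) l)) by (rewrite E0; left; auto).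
      apply filter_In in Hy. destruct Hy as [Hy Hxy]. apply Nat.eqb_eq in Hxy. subst y.
      rewrite <- E0. apply HM; auto. }
    assert (h2 : (length (filter (fun y => negb (x =? y)) l) <= length B * M)%nat).
    { apply IH.
      - intros w Hw. apply filter_In in Hw. destruct Hw as [Hw Hne].
        apply Bool.negb_true_iff, Nat.eqb_neq in Hne.
        destruct (HB w Hw); [congruence | auto].
      - intros v Hv. apply filter_In in Hv. destruct Hv as [Hv _].
        eapply Nat.le_trans; [|apply (HM v Hv)].
        unfold count. clear. induction l as [|y l IH]; simpl; [lia|].
        destruct (negb (x =? y)); simpl; destruct (v =? y); simpl; lia. }
    simpl. lia.
Qed.

(** The expanded [q]-th power of the sum over [gs]: one entry for each choice of [q] factors, with
    repetitions. *)
Fixpoint words (gs : list nat) (q : nat) : list nat :=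
  match q with
  | O => 1%nat :: nil
  | S q => flat_map (fun g => map (Nat.mul g) (words gs q)) gs
  end.

(** All products with exponents at most [q]. They cover the values of [words gs q], and their number
    [(q + 1) ^ length gs] is polynomial in [q]. *)
Fixpoint monomials (q : nat) (gs : list nat) : list nat :=
  match gs with
  | nil => 1%nat :: nil
  | g :: gs => flat_map (fun k => map (Nat.mul (g ^ k)) (monomials q gs)) (seq 0 (S q))
  end.

Lemma length_flat_map_const {A B : Type} (f : A -> list B) (l : list A) (m : nat) :
  (forall a, length (f a) = m) -> length (flat_map f l) = (length l * m)%nat.
Proof.
  intro H. induction l as [|a l IH]; simpl; auto. rewrite length_app, H, IH. lia.
Qed.

Lemma length_words (gs : list nat) (q : nat) : length (words gs q) = (length gs ^ q)%nat.
Proof.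
  induction q as [|q IH]; simpl; auto.
  rewrite (length_flat_map_const _ _ (length gs ^ q)); auto.
  intro g. rewrite length_map; auto.
Qed.

Lemma length_monomials (gs : list nat) (q : nat) :
  length (monomials q gs) = (S q ^ length gs)%nat.
Proof.
  induction gs as [|g gs IH]; auto. cbn [monomials length].
  rewrite (length_flat_map_const _ _ (S q ^ length gs)), length_seq; auto.
  intro k. rewrite length_map; auto.
Qed.

Lemma in_monomials_cons (q g w : nat) (gs : list nat) :
  In w (monomials q (g :: gs)) <->
  exists k b, (k <= q)%nat /\ In b (monomials q gs) /\ w = (g ^ k * b)%nat.
Proof.
  cbn [monomials]. rewrite in_flat_map. split.
  - intros [k [Hk Hw]]. apply in_seq in Hk. apply in_map_iff in Hw.
    destruct Hw as [b [<- Hb]]. exists k, b. repeat split; auto; lia.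
  - intros [k [b [Hk [Hb ->]]]]. exists k. split; [apply in_seq; lia|].
    apply in_map_iff. exists b; auto.
Qed.

Lemma monomials_incr (q w : nat) (gs : list nat) :
  In w (monomials q gs) -> In w (monomials (S q) gs).
Proof.
  revert w; induction gs as [|g gs IH]; intros w Hw; auto.
  apply in_monomials_cons in Hw. destruct Hw as [k [b [Hk [Hb ->]]]].
  apply in_monomials_cons. exists k, b. auto with arith.
Qed.

Lemma monomials_mul (q g w : nat) (gs : list nat) :
  In g gs -> In w (monomials q gs) -> In (g * w)%nat (monomials (S q) gs).
Proof.
  revert w; induction gs as [|g' gs IH]; intros w Hg Hw; [destruct Hg|].
  apply in_monomials_cons in Hw. destruct Hw as [k [b [Hk [Hb ->]]]].
  apply in_monomials_cons. destruct Hg as [->|Hg].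
  - exists (S k), b. split; [lia|]. split; [apply monomials_incr; auto | simpl; lia].
  - exists k, (g * b)%nat. split; [lia|]. split; [apply IH; auto | lia].
Qed.

Lemma words_monomials (q w : nat) (gs : list nat) :
  In w (words gs q) -> In w (monomials q gs).
Proof.
  revert w; induction q as [|q IH]; intros w Hw.
  - destruct Hw as [<-|[]]. clear. induction gs as [|g gs IH]; [left; auto|].
    apply in_monomials_cons. exists 0%nat, 1%nat. auto.
  - cbn [words] in Hw. apply in_flat_map in Hw. destruct Hw as [g [Hg Hw]].
    apply in_map_iff in Hw. destruct Hw as [b [<- Hb]]. apply monomials_mul; auto.
Qed.

Lemma words_pos (gs : list nat) (q w : nat) :
  (forall g, In g gs -> (0 < g)%nat) -> In w (words gs q) -> (0 < w)%nat.
Proof.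
  intro Hgs. revert w; induction q as [|q IH]; intros w Hw.
  - destruct Hw as [<-|[]]; lia.
  - cbn [words] in Hw. apply in_flat_map in Hw. destruct Hw as [g [Hg Hw]].
    apply in_map_iff in Hw. destruct Hw as [b [<- Hb]].
    specialize (Hgs g Hg). specialize (IH b Hb). nia.
Qed.

Lemma esum_words (t : R) (gs : list nat) (q : nat) :
  (forall g, In g gs -> (0 < g)%nat) ->
  Cmod (esum t (words gs q)) = Cmod (esum t gs) ^ q.
Proof.
  intro Hgs. induction q as [|q IH].
  - simpl. unfold e. change (INR 1) with 1. rewrite chi_1, ln_1, Rmult_0_r.
    replace (_ + _)%C with (RtoC 1); [apply Cmod_1|].
    unfold Cexp, Re, Im, RtoC, Cplus, Cmult; simpl. rewrite exp_0, cos_0, sin_0. f_equal; ring.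
  - simpl pow. rewrite <- IH, <- Cmod_mult. f_equal. cbn [words].
    assert (Hw := fun w => words_pos gs q w Hgs).
    revert Hw. clear IH. generalize (words gs q). intros ws Hw.
    induction gs as [|g gs IHg]; simpl; [ring|].
    rewrite esum_app, IHg by (intros; apply Hgs; right; auto).
    replace (esum t (map (Nat.mul g) ws)) with (e t g * esum t ws)%C; [ring|].
    assert (Hg : (0 < g)%nat) by (apply Hgs; left; auto).
    clear - Hw Hg chi_mul. induction ws as [|w ws IH]; simpl; [ring|].
    rewrite <- IH by (intros; apply Hw; right; auto).
    rewrite e_mul; [ring | auto | apply Hw; left; auto].
Qed.

Lemma exponential_beats_polynomial (rho : R) (N : nat) :
  1 < rho -> ~ (forall q : nat, rho ^ q <= INR (S q) ^ N).
Proof.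
  intros Hr H. set (a := ln rho).
  assert (Ha : 0 < a) by (unfold a; rewrite <- ln_1; apply ln_increasing; lra).
  assert (Hlog : forall q, INR q * a <= INR N * ln (INR (S q))).
  { intro q. unfold a. assert (0 < INR (S q)) by (apply lt_0_INR; lia).
    rewrite <- !ln_pow by lra. specialize (H q).
    destruct H as [H| ->]; [left; apply ln_increasing; auto; apply pow_lt; lra | lra]. }
  (* The exponent will be [q = k^2 - 1], so that [ln (q + 1) = 2 ln k <= 2 k] while
     [q * a >= k^2 * a / 2]. Beyond [k = 4 N / a] this is contradictory. *)
  destruct (INR_unbounded (4 * INR N / a + 2)) as [k Hk].
  assert (HN := pos_INR N).
  assert (H4 : 0 <= 4 * INR N / a).
  { apply Rmult_le_pos; [lra|]. left; apply Rinv_0_lt_compat; auto. }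
  assert (Hk2 : (2 < k)%nat) by (apply INR_lt; simpl; lra).
  specialize (Hlog (k * k - 1)%nat).
  replace (S (k * k - 1)) with (k * k)%nat in Hlog by nia.
  rewrite minus_INR, !mult_INR in Hlog by nia. rewrite ln_mult in Hlog by lra.
  simpl (INR 1) in Hlog.
  assert (Hln : ln (INR k) <= INR k).
  { assert (h := exp_ineq1_le (ln (INR k))). rewrite exp_ln in h by lra. lra. }
  assert (Hka : 4 * INR N < a * INR k).
  { apply Rmult_lt_reg_l with (/ a); [apply Rinv_0_lt_compat; auto|].
    rewrite <- (Rmult_assoc (/ a) a), Rinv_l, Rmult_1_l by lra. lra. }
  assert (INR k * INR k / 2 * a <= 2 * INR N * INR k) by nra.
  nra.
Qed.

Lemma esum_sup (gs : list nat) (S : R) :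
  (forall g, In g gs -> (0 < g)%nat) -> 0 < S -> S < INR (length gs) ->
  exists t, S < Cmod (esum t gs).
Proof.
  intros Hgs HS0 HS. apply NNPP. intro Hno.
  assert (HB : forall t, Cmod (esum t gs) <= S).
  { intro t. apply Rnot_lt_le. intro h. apply Hno. exists t; auto. }
  apply (exponential_beats_polynomial (INR (length gs) / S) (length gs)).
  { apply Rmult_lt_reg_r with S; auto. unfold Rdiv. rewrite Rmult_assoc, Rinv_l; lra. }
  intro q.
  assert (HSq : 0 < S ^ q) by (apply pow_lt; auto).
  set (W := words gs q).
  assert (Hc : forall v, In v W -> INR (count v W) <= S ^ q).
  { intros v Hv. apply count_le_sup.
    - intros w; apply words_pos; auto.
    - apply (words_pos gs q); auto.
    - intro t. unfold W. rewrite esum_words by auto. apply pow_incr. split; [apply Cmod_ge_0 | auto]. }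
  (* Multiplicities are integers, so the pigeonhole count uses the integer part [M] of [S ^ q]. *)
  destruct (nfloor_ex (S ^ q)) as [M [HM1 HM2]]; [lra|].
  assert (Hp : (length W <= length (monomials q gs) * M)%nat).
  { apply pigeonhole_count.
    - intros w; apply words_monomials.
    - intros v Hv. specialize (Hc v Hv). apply Nat.lt_succ_r, INR_lt. rewrite S_INR. lra. }
  apply le_INR in Hp. unfold W in Hp.
  rewrite length_words, length_monomials, mult_INR, !pow_INR in Hp.
  unfold Rdiv. rewrite Rpow_mult_distr, pow_inv.
  apply Rmult_le_reg_r with (S ^ q); auto. rewrite Rmult_assoc, Rinv_l, Rmult_1_r by lra.
  eapply Rle_trans; [apply Hp|]. apply Rmult_le_compat_l; auto.
  apply pow_le. apply pos_INR.
Qed.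

(** If a sum of unit vectors nearly reaches their number, no two of them can differ much. One of
    them is [e t 1 = 1], so each [e t n] is close to 1. Setting aside all but these two leaves a
    modulus of at least [2 - d]. *)
Lemma bohr_kronecker (N : nat) (delta : R) :
  0 < delta ->
  exists t, forall n, (1 <= n <= N)%nat -> 1 - delta <= chi n * cos (t * ln (INR n)).
Proof.
  intro Hd0. set (d := Rmin (delta / 2) (/ 2)).
  assert (Hd : 0 < d) by (apply Rmin_glb_lt; lra).
  assert (Hd1 : d <= delta / 2) by apply Rmin_l.
  assert (Hd2 : d <= / 2) by apply Rmin_r.
  (* The list runs up to [N + 1], so it contains 1 even for [N = 0], and [N] terms remain once 1 is
     split off. *)
  set (gs := seq 1 (S N)).
  assert (Hlen : INR (length gs) = INR N + 1) by (unfold gs; rewrite length_seq, S_INR; auto).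
  assert (HN := pos_INR N).
  destruct (esum_sup gs (INR (length gs) - d)) as [t Ht].
  - intros g Hg. apply in_seq in Hg; lia.
  - lra.
  - lra.
  - exists t. intros n [Hn1 HnN].
    destruct (Nat.eq_dec n 1) as [->|Hn].
    { change (INR 1) with 1. rewrite chi_1, ln_1, Rmult_0_r, cos_0. lra. }
    assert (Hin : In n (seq 2 N)) by (apply in_seq; lia).
    destruct (in_split _ _ Hin) as [l1 [l2 Hsp]].
    assert (Hl : INR N = INR (length (l1 ++ l2)) + 1).
    { rewrite <- S_INR. f_equal. rewrite <- (length_seq N 2), Hsp, !length_app. simpl. lia. }
    assert (He : esum t gs = ((e t 1 + e t n) + esum t (l1 ++ l2))%C).
    { unfold gs. change (seq 1 (S N)) with (1%nat :: seq 2 N). rewrite Hsp.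
      change (esum t (1%nat :: l1 ++ n :: l2)) with (e t 1 + esum t (l1 ++ n :: l2))%C.
      rewrite !esum_app. simpl. ring. }
    assert (Hm : 2 - d <= Cmod (e t 1 + e t n)%C).
    { assert (h := Cmod_triangle (e t 1 + e t n)%C (esum t (l1 ++ l2))). rewrite <- He in h.
      assert (h' := Cmod_esum_le t (l1 ++ l2)). lra. }
    assert (Hsq : Cmod (e t 1 + e t n)%C ^ 2 = 2 + 2 * (chi n * cos (t * ln (INR n)))).
    { unfold Cmod. rewrite pow2_sqrt.
      - unfold e, Cexp, Cplus, Cmult, RtoC, Re, Im; simpl.
        rewrite chi_1, ln_1, exp_0, !Rmult_0_r, cos_0, sin_0.
        assert (h := sin2_cos2 (t * ln (INR n))). unfold Rsqr in h.
        assert (h' := chi_sq n).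
        set (co := cos (t * ln (INR n))) in *. set (si := sin (t * ln (INR n))) in *.
        transitivity (1 + 2 * (chi n * co) + (chi n * chi n) * (si * si + co * co)); [ring|].
        rewrite h, h'. ring.
      - apply Rplus_le_le_0_compat; apply pow2_ge_0. }
    assert ((2 - d) ^ 2 <= Cmod (e t 1 + e t n)%C ^ 2) by (apply pow_incr; lra).
    nra.
Qed.

End Bohr.

(** * The sign character and the existence of aligned heights *)

Fixpoint two_parity_pos (p : positive) : R :=
  match p with xO q => - two_parity_pos q | _ => 1 end.

(* [(-1) ^ v] with [v] the exponent of 2 in [n] *)
Definition two_parity (n : nat) : R := two_parity_pos (Pos.of_nat n).

Lemma two_parity_pos_mul (p q : positive) :
  two_parity_pos (p * q) = two_parity_pos p * two_parity_pos q.
Proof.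
  induction p as [p IH|p IH|].
  - clear IH. induction q as [q IHq|q IHq|].
    + change (1 = 1 * 1). ring.
    + rewrite Pos.mul_xO_r. change (- two_parity_pos (p~1 * q) = 1 * - two_parity_pos q).
      rewrite IHq. simpl. ring.
    + rewrite Pos.mul_1_r. simpl. ring.
  - change (- two_parity_pos (p * q) = - two_parity_pos p * two_parity_pos q). rewrite IH. ring.
  - rewrite Pos.mul_1_l. simpl. ring.
Qed.

Lemma two_parity_mul (m n : nat) :
  (0 < m)%nat -> (0 < n)%nat -> two_parity (m * n) = two_parity m * two_parity n.
Proof.
  intros Hm Hn. unfold two_parity. rewrite Nat2Pos.inj_mul by lia. apply two_parity_pos_mul.
Qed.

Lemma two_parity_sq (n : nat) : two_parity n * two_parity n = 1.
Proof. unfold two_parity. induction (Pos.of_nat n); simpl; lra. Qed.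

Lemma two_parity_odd (k : nat) : two_parity (S (2 * k)) = 1.
Proof.
  destruct k as [|k]; [reflexivity|]. unfold two_parity.
  replace (S (2 * S k)) with (1 + 2 * S k)%nat by lia.
  rewrite Nat2Pos.inj_add, Nat2Pos.inj_mul by lia.
  change (Pos.of_nat 2) with 2%positive. destruct (Pos.of_nat (S k)); reflexivity.
Qed.

Definition zeta_aligned (t : nat -> R) : Prop :=
  is_lim_seq (fun n => cos (t n * ln 2)) (-1) /\
  forall k, is_lim_seq (fun n => cos (t n * ln (INR (S (2 * k))))) 1.

Lemma zeta_aligned_exists : exists t, zeta_aligned t.
Proof.
  destruct (choice (fun N t => forall n, (1 <= n <= N)%nat ->
     1 - / INR (S N) <= two_parity n * cos (t * ln (INR n)))) as [t Ht].
  { intro N. apply bohr_kronecker.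
    - reflexivity.
    - apply two_parity_mul.
    - apply two_parity_sq.
    - apply Rinv_0_lt_compat, lt_0_INR; lia. }
  assert (Hinv : is_lim_seq (fun n => / INR (S n)) 0).
  { apply (is_lim_seq_incr_1 (fun n => / INR n)).
    apply (is_lim_seq_inv _ p_infty); [apply is_lim_seq_INR | discriminate]. }
  assert (H : forall m, (1 <= m)%nat -> is_lim_seq (fun n => two_parity m * cos (t n * ln (INR m))) 1).
  { intros m Hm.
    apply (is_lim_seq_le_le_loc (fun n => 1 - / INR (S n)) _ (fun _ => 1)).
    - exists m. intros n Hn. split; [apply Ht; lia|].
      assert (h := two_parity_sq m). assert (h' := COS_bound (t n * ln (INR m))). nra.
    - replace (Finite 1) with (Finite (1 - 0)) by (f_equal; ring).
      apply is_lim_seq_minus'; [apply is_lim_seq_const | auto].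
    - apply is_lim_seq_const. }
  exists t. split.
  - apply (is_lim_seq_ext (fun n => -1 * (two_parity 2 * cos (t n * ln (INR 2))))).
    + intro n. change (two_parity 2) with (-(1)). change (INR 2) with 2. ring.
    + replace (Finite (-1)) with (Rbar_mult (-1) 1) by (simpl; f_equal; ring).
      apply is_lim_seq_scal_l. apply H; lia.
  - intro k. apply (is_lim_seq_ext (fun n => two_parity (S (2 * k)) * cos (t n * ln (INR (S (2 * k)))))).
    + intro n. rewrite two_parity_odd. ring.
    + apply H; lia.
Qed.

(** * The von Mangoldt function *)

Definition nprime (p : nat) : Prop :=
  (1 < p)%nat /\ forall d, Nat.divide d p -> d = 1%nat \/ d = p.

Lemma nprime_coprime (p a : nat) : nprime p -> ~ Nat.divide p a -> Nat.gcd p a = 1%nat.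
Proof.
  intros [Hp Hd] Hna. destruct (Hd _ (Nat.gcd_divide_l p a)) as [h|h]; auto.
  destruct Hna. rewrite <- h. apply Nat.gcd_divide_r.
Qed.

Lemma nprime_divide_pow (p q k : nat) : nprime p -> nprime q -> Nat.divide p (q ^ k) -> p = q.
Proof.
  intros Hp Hq. induction k as [|k IH]; intro H.
  - simpl in H. apply Nat.divide_1_r in H. destruct Hp; lia.
  - destruct (classic (Nat.divide p q)) as [h|h].
    + destruct (proj2 Hq p h); auto. destruct Hp; lia.
    + apply IH. apply (Nat.gauss p q); auto. apply nprime_coprime; auto.
Qed.

Lemma pow_coprime_divide (p q k m : nat) :
  nprime p -> nprime q -> p <> q -> Nat.divide (q ^ k) (p * m) -> Nat.divide (q ^ k) m.
Proof.
  intros Hp Hq Hne H. apply (Nat.gauss (q ^ k) p m); auto.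
  rewrite Nat.gcd_comm. apply nprime_coprime; auto.
  intro h. apply Hne. apply (nprime_divide_pow p q k); auto.
Qed.

Lemma nprime_divisor (n : nat) : (1 < n)%nat -> exists p, nprime p /\ Nat.divide p n.
Proof.
  induction n as [n IH] using lt_wf_ind; intro Hn.
  destruct (classic (nprime n)) as [h|h].
  - exists n; split; auto. apply Nat.divide_refl.
  - assert (h' : exists d, Nat.divide d n /\ d <> 1%nat /\ d <> n).
    { apply NNPP. intro Hno. apply h. split; auto. intros d Hd.
      destruct (Nat.eq_dec d 1); auto. destruct (Nat.eq_dec d n); auto.
      destruct Hno. exists d; auto. }
    destruct h' as [d [Hd [H1 H2]]].
    assert (Hle := Nat.divide_pos_le d n ltac:(lia) Hd).
    assert (d <> 0)%nat by (intros ->; destruct Hd as [x Hx]; lia).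
    destruct (IH d) as [p [Hp Hpd]]; try lia.
    exists p; split; auto. apply (Nat.divide_trans p d n); auto.
Qed.

Lemma max_power_divisor (p m : nat) :
  (1 < p)%nat -> (0 < m)%nat ->
  exists v, Nat.divide (p ^ v) m /\ ~ Nat.divide (p ^ S v) m.
Proof.
  intros Hp Hm. apply NNPP. intro Hno.
  assert (H : forall v, Nat.divide (p ^ v) m).
  { induction v as [|v IH]; [simpl; apply Nat.divide_1_l|].
    apply NNPP. intro h. apply Hno. exists v; auto. }
  specialize (H m). apply Nat.divide_pos_le in H; auto.
  assert (h := Nat.pow_gt_lin_r p m Hp). lia.
Qed.

Definition mangoldt (n : nat) : R :=
  match excluded_middle_informative (exists p, nprime p /\ exists k, n = (p ^ S k)%nat) with
  | left H => ln (INR (proj1_sig (constructive_indefinite_description _ H)))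
  | right _ => 0
  end.

(** The prime chosen in [mangoldt] is the expected one, because a prime power determines its
    base. *)
Lemma mangoldt_pow (p k : nat) : nprime p -> mangoldt (p ^ S k) = ln (INR p).
Proof.
  intro Hp. unfold mangoldt. destruct (excluded_middle_informative _) as [H|H].
  - destruct (constructive_indefinite_description _ H) as [q [Hq [k' Hk]]]. simpl proj1_sig.
    replace q with p; auto. apply (nprime_divide_pow p q (S k')); auto.
    rewrite <- Hk. exists (p ^ k)%nat. simpl. lia.
  - destruct H. exists p; split; auto. exists k; auto.
Qed.

Lemma mangoldt_cases (n : nat) :
  mangoldt n = 0 \/ exists p k, nprime p /\ n = (p ^ S k)%nat.
Proof.
  unfold mangoldt. destruct (excluded_middle_informative _) as [[p [Hp [k Hk]]]|H]; auto.
  right. exists p, k; auto.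
Qed.

Lemma ln_INR_le (m n : nat) : (0 < m)%nat -> (m <= n)%nat -> ln (INR m) <= ln (INR n).
Proof.
  intros Hm Hmn. apply le_INR in Hmn. apply lt_0_INR in Hm.
  destruct Hmn as [h| ->]; [left; apply ln_increasing; auto | lra].
Qed.

Lemma ln_INR_ge_0 (n : nat) : (0 < n)%nat -> 0 <= ln (INR n).
Proof. intro Hn. rewrite <- ln_1. change 1 with (INR 1). apply ln_INR_le; lia. Qed.

Lemma mangoldt_bounds (n : nat) : (0 < n)%nat -> 0 <= mangoldt n <= ln (INR n).
Proof.
  intro Hn. destruct (mangoldt_cases n) as [->|[p [k [Hp ->]]]].
  - split; [lra | apply ln_INR_ge_0; auto].
  - rewrite mangoldt_pow by auto. destruct Hp as [Hp _]. split; [apply ln_INR_ge_0; lia|].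
    apply ln_INR_le; [lia|]. simpl.
    assert (p ^ k <> 0)%nat by (apply Nat.pow_nonzero; lia). nia.
Qed.

Definition odd3 (i : nat) : nat := (2 * i + 3)%nat.
Definition odd1 (i : nat) : nat := S (2 * i).

Definition dvd (d n : nat) : R := if excluded_middle_informative (Nat.divide d n) then 1 else 0.

Lemma dvd_true (d n : nat) : Nat.divide d n -> dvd d n = 1.
Proof. intro H. unfold dvd. destruct (excluded_middle_informative _); tauto. Qed.

Lemma dvd_false (d n : nat) : ~ Nat.divide d n -> dvd d n = 0.
Proof. intro H. unfold dvd. destruct (excluded_middle_informative _); tauto. Qed.

Lemma sum_n_single_difference (u w : nat -> R) (i0 M : nat) :
  (i0 <= M)%nat -> (forall i, i <> i0 -> u i = w i) ->
  sum_n u M = sum_n w M + (u i0 - w i0).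
Proof.
  intros Hi H.
  assert (Hlow : forall N, (N < i0)%nat -> sum_n u N = sum_n w N).
  { induction N; intro HN; [rewrite !sum_O; apply H; lia|].
    rewrite !sum_Sn, IHN, H by lia. auto. }
  induction M as [|M IH].
  - rewrite !sum_O. replace i0 with 0%nat by lia. lra.
  - rewrite !sum_Sn. unfold plus; simpl. destruct (Nat.eq_dec i0 (S M)) as [->|Hne].
    + rewrite Hlow by lia. lra.
    + rewrite IH, (H (S M)) by lia. lra.
Qed.

Lemma odd_divisor (d n : nat) : Nat.Odd n -> Nat.divide d n -> Nat.Odd d.
Proof.
  intros [k Hk] [x Hx]. destruct (Nat.Even_or_Odd d) as [[e He]|h]; auto. nia.
Qed.

Lemma odd_ge3 (d : nat) : Nat.Odd d -> (1 < d)%nat -> exists i, d = odd3 i.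
Proof. intros [k Hk] Hd. exists (k - 1)%nat. unfold odd3. lia. Qed.

(** Strong induction by removing one prime: if [n = p m] and [p^v] is the exact power of [p] in [m],
    then [p^(v+1)] is the only prime power that divides [n] but not [m], and it contributes [ln p].
    The cutoff [M] is arbitrary as long as it covers all divisors. *)
Lemma sum_mangoldt (M n : nat) :
  Nat.Odd n -> (n <= odd3 M)%nat ->
  sum_n (fun i => dvd (odd3 i) n * mangoldt (odd3 i)) M = ln (INR n).
Proof.
  revert M. induction n as [n IH] using lt_wf_ind. intros M Hodd HM.
  destruct (le_lt_dec n 1) as [Hn|Hn].
  - assert (n = 1)%nat as -> by (destruct Hodd; lia).
    change (INR 1) with 1. rewrite ln_1.
    assert (h : forall i, dvd (odd3 i) 1 * mangoldt (odd3 i) = 0).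
    { intro i. rewrite dvd_false; [ring|]. intro h. apply Nat.divide_1_r in h. unfold odd3 in h; lia. }
    clear HM IH Hn. induction M; [rewrite sum_O; auto|]. rewrite sum_Sn, IHM, h. apply Rplus_0_l.
  - destruct (nprime_divisor n Hn) as [p [Hp [m Hm]]].
    assert (Hp1 : (1 < p)%nat) by apply Hp.
    assert (Hm0 : (0 < m)%nat) by nia.
    assert (Hmn : (m < n)%nat) by nia.
    assert (Hmo : Nat.Odd m).
    { apply (odd_divisor m n Hodd). exists p. lia. }
    destruct (max_power_divisor p m Hp1 Hm0) as [v [Hv1 Hv2]].
    assert (Hd : Nat.divide (p ^ S v) n).
    { destruct Hv1 as [x Hx]. exists x. rewrite Hm, Hx. simpl. lia. }
    assert (Hp0 : (p ^ v <> 0)%nat) by (apply Nat.pow_nonzero; lia).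
    destruct (odd_ge3 (p ^ S v)) as [i0 Hi0].
    { apply (odd_divisor _ n); auto. }
    { simpl. nia. }
    assert (Hi0M : (i0 <= M)%nat).
    { apply Nat.divide_pos_le in Hd; [|lia]. rewrite Hi0 in Hd. unfold odd3 in *. lia. }
    rewrite (sum_n_single_difference _ (fun i => dvd (odd3 i) m * mangoldt (odd3 i)) i0); auto.
    + rewrite (IH m) by (auto; lia). rewrite <- Hi0, (dvd_true _ _ Hd), (dvd_false _ _ Hv2), mangoldt_pow by auto.
      rewrite Hm, mult_INR, ln_mult by (apply lt_0_INR; lia). apply Rminus_diag_uniq; ring.
    + intros i Hi. destruct (mangoldt_cases (odd3 i)) as [->|[q [k [Hq Hk]]]]; [rewrite !Rmult_0_r; auto|].
      f_equal.
      assert (Hiff : Nat.divide (odd3 i) n <-> Nat.divide (odd3 i) m).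
      { split.
        (* For a power [q^(k+1)] with [q = p] one gets [q^k] dividing [m]: [k < v] is the wanted
           case, [k = v] is the excluded index [i0], and [k > v] contradicts the maximality of [v].
           For [q] different from [p] the factor [p] cancels by coprimality. *)
        - intro h. rewrite Hk in h |- *. destruct (Nat.eq_dec p q) as [->|Hne].
          + assert (Hkm : Nat.divide (q ^ k) m).
            { destruct h as [x Hx]. exists x. simpl in Hx. nia. }
            destruct (le_lt_dec (S k) v) as [Hkv|Hkv].
            * apply (Nat.divide_trans _ (q ^ v)); auto.
              exists (q ^ (v - S k))%nat. rewrite <- Nat.pow_add_r. f_equal; lia.
            * destruct (Nat.eq_dec k v) as [->|Hne].
              -- exfalso. apply Hi. unfold odd3 in *. lia.
              -- exfalso. apply Hv2. apply (Nat.divide_trans _ (q ^ k)); auto.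
                 exists (q ^ (k - S v))%nat. rewrite <- Nat.pow_add_r. f_equal; lia.
          + apply (pow_coprime_divide p q); auto. replace (p * m)%nat with n by lia. auto.
        - intros [x Hx]. exists (x * p)%nat. nia. }
      unfold dvd. repeat destruct (excluded_middle_informative _); tauto.
Qed.

(** * Convergence of the series over odd integers *)

(** Comparison with a telescoping series, in place of an integral: with [d = x - 1],
    [n^-x <= ((n-1)^-d - n^-d) / d]. *)
Lemma p_series (x : R) : 1 < x -> ex_series (fun j => exp (- (ln (INR (S j)) * x))).
Proof.
  intro Hx. set (d := x - 1). assert (Hd : 0 < d) by (unfold d; lra).
  apply ex_series_incr_1.
  set (g := fun k => exp (- (ln (INR (S k)) * d))).
  assert (Hstep : forall k, exp (- (ln (INR (S (S k))) * x)) <= / d * (g k - g (S k))).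
  { intro k. unfold g.
    assert (Ha : 0 < INR (S k)) by (apply lt_0_INR; lia).
    assert (Hb : INR (S (S k)) = INR (S k) + 1) by apply S_INR.
    set (n := INR (S (S k))) in *.
    (* [exp u >= 1 + u] at [u = ln (n - 1) - ln n]. *)
    assert (HL : / n <= ln n - ln (INR (S k))).
    { assert (h := exp_ineq1_le (ln (INR (S k)) - ln n)).
      unfold Rminus in h at 2. rewrite exp_plus, exp_Ropp, !exp_ln in h by lra.
      replace (INR (S k) * / n) with (1 - / n) in h by (rewrite Hb; field; lra). lra. }
    assert (E1 : exp (- (ln n * x)) = exp (- (ln n * d)) * / n).
    { replace (- (ln n * x)) with (- (ln n * d) + - ln n) by (unfold d; ring).
      rewrite exp_plus, (exp_Ropp (ln n)), exp_ln by lra. auto. }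
    assert (E2 : exp (- (ln (INR (S k)) * d)) = exp (- (ln n * d)) * exp (d * (ln n - ln (INR (S k))))).
    { rewrite <- exp_plus. f_equal. ring. }
    rewrite E1, E2.
    apply Rmult_le_reg_l with d; auto. rewrite <- (Rmult_assoc d (/ d)), Rinv_r, Rmult_1_l by lra.
    assert (h := exp_ineq1_le (d * (ln n - ln (INR (S k))))).
    assert (hp := exp_pos (- (ln n * d))).
    assert (d * / n <= exp (d * (ln n - ln (INR (S k)))) - 1) by nra.
    nra. }
  apply (ex_series_bounded _ (/ d * g 0%nat)).
  - intro k. left; apply exp_pos.
  - assert (Hs : forall n, sum_n (fun k => exp (- (ln (INR (S (S k))) * x))) n <= / d * (g 0%nat - g (S n))).
    { induction n as [|n IHn]; [rewrite sum_O; apply Hstep|].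
      rewrite sum_Sn. unfold plus; simpl. specialize (Hstep (S n)). simpl in Hstep, IHn. lra. }
    intro n. eapply Rle_trans; [apply Hs|].
    apply Rmult_le_compat_l; [left; apply Rinv_0_lt_compat; auto|].
    assert (h := exp_pos (- (ln (INR (S (S n))) * d))). fold (g (S n)) in h. lra.
Qed.

Lemma gdir_ok_le (b b' lam lam' : nat -> R) :
  gdir_ok b lam -> (forall j, Rabs (b' j) <= Rabs (b j)) -> (forall j, lam j <= lam' j) ->
  gdir_ok b' lam'.
Proof.
  intros [Hp Hc] Hb Hl. split.
  - intro j. eapply Rle_trans; eauto.
  - intros x Hx. apply (ex_series_Rle _ (fun j => Rabs (b j) * exp (- (lam j * x)))); [|auto].
    intro j. rewrite Rabs_mult, Rabs_Rabsolu, (Rabs_pos_eq (exp _)) by (left; apply exp_pos).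
    apply Rmult_le_compat; auto; [apply Rabs_pos | left; apply exp_pos|].
    apply exp_le_exp. specialize (Hl j). nra.
Qed.

Lemma gdir_ok_plus (b b' c lam : nat -> R) :
  gdir_ok b lam -> gdir_ok b' lam -> (forall j, Rabs (c j) <= Rabs (b j) + Rabs (b' j)) ->
  gdir_ok c lam.
Proof.
  intros [Hp Hc] [_ Hc'] Hb. split; auto.
  intros x Hx. apply (ex_series_Rle _ (fun j => Rabs (b j) * exp (- (lam j * x)) + Rabs (b' j) * exp (- (lam j * x)))).
  - intro j. rewrite Rabs_mult, Rabs_Rabsolu, (Rabs_pos_eq (exp _)) by (left; apply exp_pos).
    rewrite <- Rmult_plus_distr_r. apply Rmult_le_compat_r; [left; apply exp_pos | auto].
  - exact (ex_series_plus _ _ (Hc x Hx) (Hc' x Hx)).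
Qed.

Definition one_seq (j : nat) : R := 1.
Definition lnS (j : nat) : R := ln (INR (S j)).
Definition ln_odd1 (j : nat) : R := ln (INR (odd1 j)).
Definition ln_odd3 (j : nat) : R := ln (INR (odd3 j)).
Definition ln_odd3_half (j : nat) : R := ln (INR (odd3 j)) - ln 2.
Definition mangoldt3 (j : nat) : R := mangoldt (odd3 j).

Lemma ok_zeta : gdir_ok one_seq lnS.
Proof.
  split.
  - intro j. apply ln_INR_ge_0. lia.
  - intros x Hx. apply (ex_series_ext (fun j => exp (- (ln (INR (S j)) * x)))).
    + intro j. unfold one_seq, lnS. rewrite Rabs_R1. apply Rminus_diag_uniq; ring.
    + apply p_series; auto.
Qed.

Lemma ok_odd1 : gdir_ok one_seq ln_odd1.
Proof.
  apply (gdir_ok_le one_seq _ lnS); [apply ok_zeta | intro; lra|].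
  intro j. apply ln_INR_le; unfold odd1; lia.
Qed.

(** [2 (j + 1) <= 2 j + 3], so the half-integers [m / 2] dominate the positive integers. *)
Lemma ok_odd3_half : gdir_ok one_seq ln_odd3_half.
Proof.
  apply (gdir_ok_le one_seq _ lnS); [apply ok_zeta | intro; lra|].
  intro j. unfold lnS, ln_odd3_half.
  assert (ln 2 + ln (INR (S j)) <= ln (INR (odd3 j))); [|lra].
  change 2 with (INR 2). rewrite <- ln_mult, <- mult_INR by (apply lt_0_INR; lia).
  apply ln_INR_le; unfold odd3; lia.
Qed.

Lemma mangoldt3_bounds (j : nat) : 0 <= mangoldt3 j <= ln_odd3 j.
Proof. apply mangoldt_bounds. unfold odd3; lia. Qed.

Lemma ln2_pos : 0 < ln 2.
Proof. rewrite <- ln_1. apply ln_increasing; lra. Qed.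

(** [Lambda(m) <= ln m = ln (m / 2) + ln 2]: the coefficients are dominated by those of the
    differentiated series plus a constant. *)
Lemma ok_mangoldt_half : gdir_ok mangoldt3 ln_odd3_half.
Proof.
  assert (h2 := ln2_pos).
  apply (gdir_ok_plus (fun j => one_seq j * ln_odd3_half j) (fun _ => ln 2)).
  - apply gdir_ok_deriv, ok_odd3_half.
  - split; [apply (gdir_lam_pos _ _ ok_odd3_half)|]. intros x Hx.
    apply (ex_series_ext (fun j => ln 2 * (Rabs (one_seq j) * exp (- (ln_odd3_half j * x))))).
    + intro j. unfold one_seq. rewrite Rabs_R1, (Rabs_pos_eq (ln 2)) by lra.
      apply Rminus_diag_uniq; ring.
    + apply (ex_series_scal_l (ln 2) (fun j => Rabs (one_seq j) * exp (- (ln_odd3_half j * x)))).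
      apply (gdir_conv _ _ ok_odd3_half); auto.
  - intro j. assert (h := mangoldt3_bounds j). assert (h' := gdir_lam_pos _ _ ok_odd3_half j).
    unfold one_seq. rewrite Rmult_1_l, !Rabs_pos_eq by lra. unfold ln_odd3_half, ln_odd3 in *. lra.
Qed.

Lemma ok_mangoldt : gdir_ok mangoldt3 ln_odd3.
Proof.
  apply (gdir_ok_le mangoldt3 _ ln_odd3_half); [apply ok_mangoldt_half | intro; lra|].
  intro j. assert (h := ln2_pos). unfold ln_odd3, ln_odd3_half. lra.
Qed.

(** Even indices carry the series [2^s L s], odd indices [- L s]. Interleaving makes [(2^s - 1) L s]
    a single series of the general form, to which the results on alignment apply. *)
Definition K_coef (n : nat) : R :=
  if Nat.even n then mangoldt3 (Nat.div2 n) else - mangoldt3 (Nat.div2 n).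
Definition K_freq (n : nat) : R :=
  if Nat.even n then ln_odd3_half (Nat.div2 n) else ln_odd3 (Nat.div2 n).

Lemma even_double (m : nat) : Nat.even (2 * m) = true.
Proof. apply Nat.even_spec. exists m; auto. Qed.

Lemma even_S_double (m : nat) : Nat.even (S (2 * m)) = false.
Proof. rewrite Nat.even_succ, <- Nat.negb_even, even_double. auto. Qed.

Lemma K_even (m : nat) : K_coef (2 * m) = mangoldt3 m /\ K_freq (2 * m) = ln_odd3_half m.
Proof. unfold K_coef, K_freq. rewrite even_double, Nat.div2_double. auto. Qed.

Lemma K_odd (m : nat) : K_coef (S (2 * m)) = - mangoldt3 m /\ K_freq (S (2 * m)) = ln_odd3 m.
Proof. unfold K_coef, K_freq. rewrite even_S_double, Nat.div2_succ_double. auto. Qed.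

Lemma ex_series_of_pairs (u : nat -> R) :
  (forall n, 0 <= u n) -> ex_series (fun m => u (2 * m)%nat + u (S (2 * m))) -> ex_series u.
Proof.
  intros Hu [l Hl]. apply (ex_series_bounded u l); auto.
  intro n. apply Rle_trans with (sum_n u (S (2 * n))).
  - assert (Hm : forall d, sum_n u n <= sum_n u (n + d)).
    { induction d as [|d IH]; [rewrite Nat.add_0_r; lra|].
      rewrite Nat.add_succ_r, sum_Sn. unfold plus; simpl. specialize (Hu (S (n + d))). lra. }
    replace (S (2 * n)) with (n + S n)%nat by lia. apply Hm.
  - rewrite <- sum_n_pairs. apply sum_n_le_series; auto.
    intro k. specialize (Hu (2 * k)%nat) as h1. specialize (Hu (S (2 * k))) as h2. lra.
Qed.

Lemma ok_K : gdir_ok K_coef K_freq.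
Proof.
  split.
  - intro j. unfold K_freq. destruct (Nat.even j).
    + apply (gdir_lam_pos _ _ ok_mangoldt_half).
    + apply (gdir_lam_pos _ _ ok_mangoldt).
  - intros x Hx. apply ex_series_of_pairs.
    + intro n. apply Rmult_le_pos; [apply Rabs_pos | left; apply exp_pos].
    + eapply ex_series_ext; [|exact (ex_series_plus _ _ (gdir_conv _ _ ok_mangoldt_half x Hx)
                                      (gdir_conv _ _ ok_mangoldt x Hx))].
      intro m. destruct (K_even m) as [-> ->]. destruct (K_odd m) as [-> ->].
      rewrite Rabs_Ropp. auto.
Qed.

(** The extreme case is [m = 3]; [ln (3 / 2)] is the lower bound [l0] used for both equations. *)
Lemma ln_odd3_half_ge (j : nat) : ln (3 / 2) <= ln_odd3_half j.
Proof.
  unfold ln_odd3_half. rewrite ln_div by lra.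
  assert (h := ln_INR_le 3 (odd3 j) ltac:(lia) ltac:(unfold odd3; lia)).
  replace (INR 3) with 3 in h by (simpl; lra). lra.
Qed.

Lemma ln_3_2_pos : 0 < ln (3 / 2).
Proof. rewrite <- ln_1. apply ln_increasing; lra. Qed.

Lemma K_freq_ge (n : nat) : ln (3 / 2) <= K_freq n.
Proof.
  assert (h := ln2_pos).
  unfold K_freq. destruct (Nat.even n); [apply ln_odd3_half_ge|].
  assert (h' := ln_odd3_half_ge (Nat.div2 n)). unfold ln_odd3_half, ln_odd3 in *. lra.
Qed.

(** * The zeta function in terms of odd integers *)

Lemma is_csum_unique (a : nat -> C) (l l' : C) : is_csum a l -> is_csum a l' -> l = l'.
Proof. intros H H'. rewrite <- (is_csum_CSeries _ _ H). apply is_csum_CSeries; auto. Qed.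

Lemma is_csum_decr_1 (a : nat -> C) (l : C) :
  is_csum (fun n => a (S n)) l -> is_csum a (a 0%nat + l)%C.
Proof.
  intros [H1 H2]; split.
  - apply (is_series_decr_1 (fun n => Re (a n))).
    replace (plus _ _) with (Re l); [exact H1|].
    unfold plus, opp, Re, Cplus; simpl. ring.
  - apply (is_series_decr_1 (fun n => Im (a n))).
    replace (plus _ _) with (Im l); [exact H2|].
    unfold plus, opp, Im, Cplus; simpl. ring.
Qed.

Lemma is_csum_real_scal (x : nat -> R) (X : R) (w : C) :
  is_series x X -> is_csum (fun n => RtoC (x n) * w)%C (RtoC X * w)%C.
Proof.
  intro H. apply (is_csum_ext (fun n => w * RtoC (x n))%C); [intro; ring|].
  rewrite Cmult_comm. apply is_csum_scal. split; [exact H|].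
  apply (is_series_ext (fun _ => 0)); [reflexivity|].
  assert (h := is_series_finite (fun _ => 0) 0 (fun _ _ => eq_refl)). rewrite sum_O in h. exact h.
Qed.

(** Fubini's theorem under absolute convergence, reduced to real series: the partial sums along a
    column are bounded by the sum [A i] of the moduli in that column. *)
Lemma csum_swap (c : nat -> nat -> C) (A : nat -> R) (row col : nat -> C) :
  (forall i, is_series (fun j => Cmod (c j i)) (A i)) -> ex_series A ->
  (forall i, is_csum (fun j => c j i) (col i)) ->
  (forall j, is_csum (fun i => c j i) (row j)) ->
  is_csum row (CSeries col).
Proof.
  intros HA EA Hcol Hrow.
  assert (H1 : forall j i, Cmod (c j i) <= A i).
  { intros j i. apply (term_le_series (fun j => Cmod (c j i))); auto. intro; apply Cmod_ge_0. }
  assert (H2 : forall (f : C -> R), (forall z, Rabs (f z) <= Cmod z) ->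
                forall i N, Rabs (sum_n (fun j => f (c j i)) N) <= A i).
  { intros f Hf i N. apply Rle_trans with (sum_n (fun j => Cmod (c j i)) N).
    - induction N as [|N IH]; [rewrite !sum_O; auto|].
      rewrite !sum_Sn. unfold plus; simpl. eapply Rle_trans; [apply Rabs_triang|].
      specialize (Hf (c (S N) i)). lra.
    - apply sum_n_le_series; auto. intro; apply Cmod_ge_0. }
  split.
  - apply (is_series_ext (fun j => Series (fun i => Re (c j i)))).
    { intro j. apply is_series_unique, Hrow. }
    replace (Re (CSeries col)) with (Series (fun i => Series (fun j => Re (c j i)))).
    + apply (series_swap (fun j i => Re (c j i)) A); auto.
      * intros j i. eapply Rle_trans; [apply Re_le_Cmod | auto].
      * intros i N. apply (H2 Re); auto. apply Re_le_Cmod.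
      * intro i. eexists; apply Hcol.
    + apply Series_ext. intro i. apply is_series_unique, Hcol.
  - apply (is_series_ext (fun j => Series (fun i => Im (c j i)))).
    { intro j. apply is_series_unique, Hrow. }
    replace (Im (CSeries col)) with (Series (fun i => Series (fun j => Im (c j i)))).
    + apply (series_swap (fun j i => Im (c j i)) A); auto.
      * intros j i. eapply Rle_trans; [apply Im_le_Cmod | auto].
      * intros i N. apply (H2 Im); auto. apply Im_le_Cmod.
      * intro i. eexists; apply Hcol.
    + apply Series_ext. intro i. apply is_series_unique, Hcol.
Qed.

Definition two_pow_neg (s : C) : C := Cexp (- (RtoC (ln 2) * s))%C.

Lemma Cexp_freq_plus (a b : R) (s : C) :
  Cexp (- (RtoC (a + b) * s))%C = (Cexp (- (RtoC a * s)) * Cexp (- (RtoC b * s)))%C.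
Proof. rewrite <- Cexp_plus, RtoC_plus. f_equal. ring. Qed.

Lemma lnS_even (m : nat) : lnS (S (2 * m)) = ln 2 + lnS m.
Proof.
  unfold lnS. replace (S (S (2 * m))) with (2 * S m)%nat by lia.
  rewrite mult_INR, ln_mult by (apply lt_0_INR; lia). reflexivity.
Qed.

Lemma ln_odd1_S (j : nat) : ln_odd1 (S j) = ln 2 + ln_odd3_half j.
Proof.
  unfold ln_odd1, ln_odd3_half. replace (odd1 (S j)) with (odd3 j) by (unfold odd1, odd3; lia). ring.
Qed.

Definition zeta0 (s : C) : C := gdir one_seq lnS s.
(** This is [- zeta']: the factors [- ln n] produced by differentiation are entered with a plus
    sign. [Zodd1] follows the same convention. *)
Definition zeta1 (s : C) : C := gdir (fun j => (one_seq j * lnS j)%R) lnS s.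
Definition Zodd (s : C) : C := gdir one_seq ln_odd1 s.
Definition Zodd1 (s : C) : C := gdir (fun j => (one_seq j * ln_odd1 j)%R) ln_odd1 s.
Definition Fodd (s : C) : C := gdir one_seq ln_odd3_half s.
Definition Lodd (s : C) : C := gdir mangoldt3 ln_odd3 s.
Definition Kodd (s : C) : C := gdir K_coef K_freq s.

(** Grouping in pairs separates parities: index [2 m] is the odd integer [2 m + 1], index [2 m + 1]
    the even integer [2 (m + 1)], whose term has the factor [2^-s]. *)
Lemma zeta0_odd (s : C) : 1 < Re s -> zeta0 s = (Zodd s + two_pow_neg s * zeta0 s)%C.
Proof.
  intro Hs. assert (H := gdir_correct _ _ ok_zeta s Hs).
  apply (is_csum_unique _ _ _ (is_csum_pairs _ _ H)).
  apply (is_csum_ext (fun m => gterm one_seq ln_odd1 s m + two_pow_neg s * gterm one_seq lnS s m)%C).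
  - intro m. unfold gterm. rewrite lnS_even, Cexp_freq_plus.
    change (lnS (2 * m)) with (ln_odd1 m). unfold one_seq, two_pow_neg. ring.
  - apply is_csum_plus; [apply (gdir_correct _ _ ok_odd1 s Hs) | apply is_csum_scal; exact H].
Qed.

Lemma zeta1_odd (s : C) : 1 < Re s ->
  zeta1 s = (Zodd1 s + two_pow_neg s * (RtoC (ln 2) * zeta0 s + zeta1 s))%C.
Proof.
  intro Hs. assert (H := gdir_correct _ _ (gdir_ok_deriv _ _ ok_zeta) s Hs).
  apply (is_csum_unique _ _ _ (is_csum_pairs _ _ H)).
  apply (is_csum_ext (fun m => gterm (fun j => one_seq j * ln_odd1 j)%R ln_odd1 s m
     + two_pow_neg s * (RtoC (ln 2) * gterm one_seq lnS s m
                        + gterm (fun j => one_seq j * lnS j)%R lnS s m))%C).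
  - intro m. unfold gterm. rewrite lnS_even, Cexp_freq_plus.
    change (lnS (2 * m)) with (ln_odd1 m). unfold one_seq, two_pow_neg.
    rewrite !RtoC_mult, RtoC_plus. ring.
  - apply is_csum_plus; [apply (gdir_correct _ _ (gdir_ok_deriv _ _ ok_odd1) s Hs)|].
    apply is_csum_scal, is_csum_plus; [|exact H].
    apply is_csum_scal. apply (gdir_correct _ _ ok_zeta s Hs).
Qed.

Lemma Cexp_0 : Cexp (RtoC 0) = RtoC 1.
Proof. unfold Cexp, RtoC, Re, Im; simpl. rewrite exp_0, cos_0, sin_0. f_equal; ring. Qed.

Lemma Zodd_F (s : C) : 1 < Re s -> Zodd s = (RtoC 1 + two_pow_neg s * Fodd s)%C.
Proof.
  intro Hs. apply (is_csum_unique _ _ _ (gdir_correct _ _ ok_odd1 s Hs)).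
  replace (RtoC 1) with (gterm one_seq ln_odd1 s 0).
  - apply is_csum_decr_1.
    apply (is_csum_ext (fun m => two_pow_neg s * gterm one_seq ln_odd3_half s m)%C).
    + intro m. unfold gterm. rewrite ln_odd1_S, Cexp_freq_plus. unfold one_seq, two_pow_neg. ring.
    + apply is_csum_scal. apply (gdir_correct _ _ ok_odd3_half s Hs).
  - unfold gterm, one_seq, ln_odd1, odd1. change (INR (S (2 * 0))) with 1. rewrite ln_1.
    replace (- (RtoC 0 * s))%C with (RtoC 0) by ring. rewrite Cexp_0. ring.
Qed.

(** The identity [K = (2^s - 1) L] multiplied by [2^-s], so that only [two_pow_neg] occurs. *)
Lemma Kodd_L (s : C) : 1 < Re s ->
  (two_pow_neg s * Kodd s)%C = ((RtoC 1 - two_pow_neg s) * Lodd s)%C.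
Proof.
  intro Hs.
  apply (is_csum_unique (fun m => (RtoC 1 - two_pow_neg s) * gterm mangoldt3 ln_odd3 s m)%C).
  - apply (is_csum_ext (fun m => two_pow_neg s * (gterm K_coef K_freq s (2 * m)%nat
                                     + gterm K_coef K_freq s (S (2 * m))))%C).
    + intro m. unfold gterm. destruct (K_even m) as [-> ->]. destruct (K_odd m) as [-> ->].
      replace (ln_odd3 m) with (ln 2 + ln_odd3_half m) by (unfold ln_odd3_half, ln_odd3; ring).
      rewrite Cexp_freq_plus, RtoC_opp. unfold two_pow_neg. ring.
    + apply is_csum_scal, is_csum_pairs, (gdir_correct _ _ ok_K s Hs).
  - apply is_csum_scal, (gdir_correct _ _ ok_mangoldt s Hs).
Qed.

(** The solution [j] of [2 j + 1 = (2 i + 3) (2 k + 1)]: the position, among the odd integers, of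
    the [k]-th odd multiple of [odd3 i]. *)
Definition multiple_index (i k : nat) : nat := (odd3 i * k + i + 1)%nat.

Lemma odd1_multiple_index (i k : nat) : odd1 (multiple_index i k) = (odd3 i * odd1 k)%nat.
Proof. unfold odd1, multiple_index, odd3. nia. Qed.

Lemma not_multiple_index (i j : nat) :
  (forall k, j <> multiple_index i k) -> ~ Nat.divide (odd3 i) (odd1 j).
Proof.
  intros H [q Hq].
  assert (Hodd : Nat.Odd q).
  { apply (odd_divisor q (odd1 j)); [exists j; unfold odd1; lia | exists (odd3 i); lia]. }
  destruct Hodd as [k ->]. apply (H k). unfold odd1, multiple_index, odd3 in *. nia.
Qed.

(* The Dirichlet convolution [log = Lambda * 1] restricted to odd integers. *)
Lemma Zodd1_convolution (s : C) : 1 < Re s -> Zodd1 s = (Lodd s * Zodd s)%C.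
Proof.
  intro Hs. set (x := Re s) in *.
  (* Row [j] sums to [ln m * m^-s] with [m = odd1 j], by [sum_mangoldt]. Column [i] runs over the
     multiples of [odd3 i] and sums to the [i]-th term of [Lodd] times [Zodd]. *)
  set (c := fun j i => (RtoC (dvd (odd3 i) (odd1 j) * mangoldt3 i) * Cexp (- (RtoC (ln_odd1 j) * s)))%C).
  assert (Hphi : forall i k, (multiple_index i k < multiple_index i (S k))%nat).
  { intros i k. unfold multiple_index, odd3. nia. }
  assert (Hz : forall i j, (forall k, j <> multiple_index i k) -> c j i = RtoC 0).
  { intros i j Hj. unfold c. rewrite dvd_false by (apply not_multiple_index; auto).
    rewrite Rmult_0_l. ring. }
  assert (Hlog : forall i k, ln_odd1 (multiple_index i k) = ln_odd3 i + ln_odd1 k).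
  { intros i k. unfold ln_odd1, ln_odd3. rewrite odd1_multiple_index, mult_INR, ln_mult; auto;
      apply lt_0_INR; unfold odd1, odd3; lia. }
  assert (Hdv : forall i k, dvd (odd3 i) (odd1 (multiple_index i k)) = 1).
  { intros i k. apply dvd_true. rewrite odd1_multiple_index. apply Nat.divide_factor_l. }
  assert (Hck : forall i k, c (multiple_index i k) i
                 = (gterm mangoldt3 ln_odd3 s i * gterm one_seq ln_odd1 s k)%C).
  { intros i k. unfold c, gterm. rewrite Hdv, Hlog, Cexp_freq_plus, Rmult_1_l. unfold one_seq. ring. }
  assert (Hb : forall i j, Cmod (c j i) <= mangoldt3 i * (Rabs (one_seq j) * exp (- (ln_odd1 j * x)))).
  { intros i j. assert (hm := mangoldt3_bounds i).
    replace (Cmod (c j i)) with (dvd (odd3 i) (odd1 j) * mangoldt3 i * exp (- (ln_odd1 j * x))).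
    - unfold one_seq. rewrite Rabs_R1, Rmult_1_l, Rmult_assoc.
      assert (hp : 0 <= mangoldt3 i * exp (- (ln_odd1 j * x)))
        by (apply Rmult_le_pos; [lra | left; apply exp_pos]).
      unfold dvd. destruct (excluded_middle_informative _); lra.
    - unfold c. rewrite Cmod_mult, Cmod_R, Cmod_Cexp, Rabs_pos_eq.
      + do 2 f_equal. unfold x. destruct s; unfold Re; simpl; ring.
      + unfold dvd. destruct (excluded_middle_informative _); lra. }
  assert (Hbex : forall i, ex_series (fun j => mangoldt3 i * (Rabs (one_seq j) * exp (- (ln_odd1 j * x))))).
  { intro i. apply (ex_series_scal_l (mangoldt3 i) (fun j => Rabs (one_seq j) * exp (- (ln_odd1 j * x)))).
    apply (gdir_conv _ _ ok_odd1); auto. }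
  assert (Hmain : is_csum (gterm (fun j => one_seq j * ln_odd1 j)%R ln_odd1 s)
                    (CSeries (fun i => Zodd s * gterm mangoldt3 ln_odd3 s i)%C)).
  { apply (csum_swap c (fun i => gabs one_seq ln_odd1 x * Cmod (gterm mangoldt3 ln_odd3 s i))).
    - intro i.
      assert (Hex : ex_series (fun j => Cmod (c j i))).
      { apply (ex_series_Rle _ _) with (2 := Hbex i).
        intro j. rewrite Rabs_pos_eq by apply Cmod_ge_0. apply Hb. }
      replace (gabs one_seq ln_odd1 x * Cmod (gterm mangoldt3 ln_odd3 s i))
        with (Series (fun j => Cmod (c j i))); [apply Series_correct; auto|].
      assert (Hsub := is_series_subseq (multiple_index i) (fun j => Cmod (c j i)) _ (Hphi i)
                 (fun j Hj => eq_trans (f_equal Cmod (Hz i j Hj)) Cmod_0) (Series_correct _ Hex)).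
      rewrite <- (is_series_unique _ _ Hsub). unfold gabs.
      rewrite Rmult_comm, <- Series_scal_l. apply Series_ext. intro k.
      rewrite Hck, Cmod_mult, (Cmod_gterm one_seq). reflexivity.
    - apply (ex_series_scal_l (gabs one_seq ln_odd1 x) (fun i => Cmod (gterm mangoldt3 ln_odd3 s i))).
      eapply ex_series_ext; [|exact (gdir_conv _ _ ok_mangoldt x Hs)].
      intro i. rewrite Cmod_gterm. reflexivity.
    - intro i.
      assert (Hs1 := CSeries_correct _ _ (Hb i) (Hbex i)).
      replace (Zodd s * gterm mangoldt3 ln_odd3 s i)%C with (CSeries (fun j => c j i)); auto.
      apply (is_csum_unique _ _ _ (is_csum_subseq (multiple_index i) _ _ (Hphi i) (Hz i) Hs1)).
      apply (is_csum_ext (fun k => gterm mangoldt3 ln_odd3 s i * gterm one_seq ln_odd1 s k)%C).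
      { intro k. rewrite Hck; auto. }
      rewrite Cmult_comm. apply is_csum_scal. apply (gdir_correct _ _ ok_odd1 s Hs).
    (* The row is a finite sum: [odd3 i] exceeds [odd1 j] as soon as [i >= j]. *)
    - intro j. unfold gterm, c, one_seq. rewrite Rmult_1_l. apply is_csum_real_scal.
      unfold ln_odd1 at 1.
      rewrite <- (sum_mangoldt j (odd1 j)); [|exists j; unfold odd1; lia | unfold odd1, odd3; lia].
      apply (is_series_finite (fun i => dvd (odd3 i) (odd1 j) * mangoldt (odd3 i))).
      intros i Hi. rewrite dvd_false; [ring|]. intro h.
      apply Nat.divide_pos_le in h; unfold odd1, odd3 in *; lia. }
  unfold Zodd1, gdir. rewrite (is_csum_CSeries _ _ Hmain).
  rewrite (is_csum_CSeries _ _ (is_csum_scal (Zodd s) _ _ (gdir_correct _ _ ok_mangoldt s Hs))).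
  unfold Lodd. ring.
Qed.

Lemma Cmod_two_pow_neg (s : C) : Cmod (two_pow_neg s) = exp (- (ln 2 * Re s)).
Proof.
  unfold two_pow_neg. rewrite Cmod_Cexp. f_equal. destruct s; unfold Re; simpl; ring.
Qed.

Lemma two_pow_neg_lt_1 (s : C) : 1 < Re s -> Cmod (two_pow_neg s) < 1.
Proof.
  intro Hs. rewrite Cmod_two_pow_neg, <- exp_0. apply exp_increasing.
  assert (h := ln2_pos). nra.
Qed.

Lemma two_pow_neg_neq (s : C) : 1 < Re s ->
  two_pow_neg s <> RtoC 0 /\ (RtoC 1 - two_pow_neg s)%C <> RtoC 0.
Proof.
  intro Hs. split; intro h.
  - assert (h' := Cmod_two_pow_neg s). rewrite h, Cmod_0 in h'.
    assert (hp := exp_pos (- (ln 2 * Re s))). lra.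
  - assert (h' := two_pow_neg_lt_1 s Hs).
    replace (two_pow_neg s) with (RtoC 1) in h'.
    + rewrite Cmod_1 in h'. lra.
    + replace (two_pow_neg s) with (RtoC 1 - (RtoC 1 - two_pow_neg s))%C by ring. rewrite h. ring.
Qed.

Lemma zeta0_F (s : C) : 1 < Re s ->
  ((RtoC 1 - two_pow_neg s) * zeta0 s = RtoC 1 + two_pow_neg s * Fodd s)%C.
Proof.
  intro Hs. rewrite <- Zodd_F by auto.
  replace (Zodd s) with (Zodd s + two_pow_neg s * zeta0 s - two_pow_neg s * zeta0 s)%C by ring.
  rewrite <- zeta0_odd by auto. ring.
Qed.

(** The logarithmic derivative of [Zodd = (1 - 2^-s) zeta0], computed from [Zodd1 = Lodd * Zodd];
    the term in [ln 2] stems from the factor [1 - 2^-s]. *)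
Lemma zeta1_L (s : C) : 1 < Re s ->
  ((RtoC 1 - two_pow_neg s) * zeta1 s
   = zeta0 s * ((RtoC 1 - two_pow_neg s) * Lodd s + two_pow_neg s * RtoC (ln 2)))%C.
Proof.
  intro Hs.
  assert (HZ : Zodd s = ((RtoC 1 - two_pow_neg s) * zeta0 s)%C).
  { rewrite zeta0_F, <- Zodd_F; auto. }
  assert (H1 : Zodd1 s = (zeta1 s - two_pow_neg s * (RtoC (ln 2) * zeta0 s + zeta1 s))%C).
  { rewrite (zeta1_odd s Hs) at 1. ring. }
  rewrite Zodd1_convolution, HZ in H1 by auto.
  replace ((RtoC 1 - two_pow_neg s) * zeta1 s)%C with
    (zeta1 s - two_pow_neg s * (RtoC (ln 2) * zeta0 s + zeta1 s)
     + two_pow_neg s * (RtoC (ln 2) * zeta0 s))%C by ring.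
  rewrite <- H1. ring.
Qed.

Lemma zeta1_K (s : C) : 1 < Re s ->
  ((RtoC 1 - two_pow_neg s) * zeta1 s
   = zeta0 s * two_pow_neg s * (Kodd s + RtoC (ln 2)))%C.
Proof.
  intro Hs. rewrite zeta1_L by auto. rewrite <- Kodd_L by auto. ring.
Qed.

(** * The equations for zeta and its derivative in the half-plane of convergence *)

Lemma zeta_zeta0 (s : C) : 1 < Re s -> zeta s = zeta0 s.
Proof.
  intro Hs. unfold zeta. destruct (Rlt_dec 1 (Re s)) as [_|h]; [|lra].
  apply is_csum_CSeries. apply (is_csum_ext (gterm one_seq lnS s)).
  - intro n. unfold gterm, npow, one_seq, lnS. rewrite Cmult_1_l. f_equal. ring.
  - apply (gdir_correct _ _ ok_zeta s Hs).
Qed.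

Lemma gdir_derive (b lam : nat -> R) (s : C) :
  gdir_ok b lam -> 1 < Re s ->
  is_derive (K := C_AbsRing) (V := C_NormedModule) (gdir b lam) s
    (- gdir (fun j => (b j * lam j)%R) lam s)%C.
Proof.
  intros Hok Hs. split; [apply is_linear_scal_l|].
  intros y Hy.
  apply (is_filter_lim_locally_unique (V := AbsRing_NormedModule C_AbsRing) s y) in Hy.
  subst y. intro eps.
  set (x := (1 + Re s) / 2).
  set (M := gabs (fun j => (b j * lam j * lam j)%R) lam x).
  assert (HM : 0 <= M).
  { apply gabs_ge_0; [apply (gdir_ok_deriv _ _ (gdir_ok_deriv _ _ Hok)) | unfold x; lra]. }
  assert (Hd : 0 < Rmin (Re s - x) (eps / (4 * M + 1))).
  { apply Rmin_glb_lt; [unfold x; lra|]. destruct eps as [e He]; simpl.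
    apply Rmult_lt_0_compat; auto. apply Rinv_0_lt_compat; lra. }
  exists (mkposreal _ Hd). intros z Hz.
  change (Cmod (z - s)%C < Rmin (Re s - x) (eps / (4 * M + 1))) in Hz.
  change (Cmod ((gdir b lam z - gdir b lam s) - (z - s) * - gdir (fun j => (b j * lam j)%R) lam s)%C
          <= eps * Cmod (z - s)%C).
  assert (Hz1 : Cmod (z - s)%C < Re s - x) by (eapply Rlt_le_trans; [exact Hz | apply Rmin_l]).
  assert (Hz2 : Cmod (z - s)%C < eps / (4 * M + 1)) by (eapply Rlt_le_trans; [exact Hz | apply Rmin_r]).
  (* Taking the radius equal to [Cmod (z - s)] makes the remainder quadratic in the increment. *)
  assert (HI := gdir_increment b lam z s s x (Cmod (z - s)%C) Hok).
  assert (HzR : x <= Re z).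
  { assert (h := Re_le_Cmod (z - s)%C).
    assert (h' : Rabs (Re z - Re s) <= Cmod (z - s)%C) by exact h.
    apply Rabs_le_between in h'. lra. }
  replace ((gdir b lam z - gdir b lam s) - (z - s) * - gdir (fun j => (b j * lam j)%R) lam s)%C
    with (gdir b lam z - gdir b lam s + gdir (fun j => (b j * lam j)%R) lam s * (z - s))%C by ring.
  eapply Rle_trans; [apply HI; unfold x in *; try lra|].
  - replace (s - s)%C with (RtoC 0) by ring. rewrite Cmod_0. apply Cmod_ge_0.
  - fold M. assert (hp := Cmod_ge_0 (z - s)%C).
    assert (h : (4 * M + 1) * Cmod (z - s)%C < eps).
    { apply Rmult_lt_reg_l with (/ (4 * M + 1)); [apply Rinv_0_lt_compat; lra|].
      rewrite <- Rmult_assoc, Rinv_l, Rmult_1_l by lra. rewrite Rmult_comm. exact Hz2. }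
    nra.
Qed.

Lemma zeta_derive (s : C) : 1 < Re s ->
  is_derive (K := C_AbsRing) (V := C_NormedModule) zeta s (- zeta1 s)%C.
Proof.
  intro Hs. apply (is_derive_ext_loc (gdir one_seq lnS)).
  - assert (Hd : 0 < Re s - 1) by lra.
    exists (mkposreal _ Hd). intros z Hz. change (Cmod (z - s)%C < Re s - 1) in Hz.
    symmetry. apply zeta_zeta0.
    assert (h' : Rabs (Re z - Re s) <= Cmod (z - s)%C) by exact (Re_le_Cmod (z - s)%C).
    apply Rabs_le_between in h'. lra.
  - apply gdir_derive; auto. apply ok_zeta.
Qed.

Lemma zeta_one_iff (s : C) : 1 < Re s -> (zeta s = RtoC 1 <-> Fodd s = RtoC (- (1))).
Proof.
  intro Hs. rewrite zeta_zeta0 by auto.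
  destruct (two_pow_neg_neq s Hs) as [N0 N1]. assert (H := zeta0_F s Hs).
  split; intro h.
  - rewrite h in H.
    replace (Fodd s) with ((RtoC 1 + two_pow_neg s * Fodd s - RtoC 1) / two_pow_neg s)%C
      by (field; auto).
    rewrite <- H, RtoC_opp. field. auto.
  - rewrite h in H.
    replace (zeta0 s) with (((RtoC 1 - two_pow_neg s) * zeta0 s) / (RtoC 1 - two_pow_neg s))%C
      by (field; auto).
    rewrite H, RtoC_opp. field. auto.
Qed.

Lemma zeta'_zero_of_K (s : C) : 1 < Re s -> Kodd s = RtoC (- ln 2) ->
  is_derive (K := C_AbsRing) (V := C_NormedModule) zeta s (RtoC 0).
Proof.
  intros Hs HK. destruct (two_pow_neg_neq s Hs) as [N0 N1]. assert (H := zeta1_K s Hs).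
  replace (RtoC 0) with (- zeta1 s)%C; [apply zeta_derive; auto|].
  replace (zeta1 s) with (((RtoC 1 - two_pow_neg s) * zeta1 s) / (RtoC 1 - two_pow_neg s))%C
      by (field; auto).
  rewrite H, HK, RtoC_opp. field. auto.
Qed.

(** The hypothesis on [zeta0 s] excludes multiple zeros of zeta, where [zeta1_K] says nothing about
    [Kodd s]. *)
Lemma K_of_zeta'_zero (s : C) : 1 < Re s -> zeta0 s <> RtoC 0 ->
  is_derive (K := C_AbsRing) (V := C_NormedModule) zeta s (RtoC 0) -> Kodd s = RtoC (- ln 2).
Proof.
  intros Hs Hz Hd. destruct (two_pow_neg_neq s Hs) as [N0 N1]. assert (H := zeta1_K s Hs).
  assert (H1 : zeta1 s = RtoC 0).
  { assert (h := is_C_derive_unique _ _ _ Hd).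
    rewrite (is_C_derive_unique _ _ _ (zeta_derive s Hs)) in h.
    replace (zeta1 s) with (- - zeta1 s)%C by ring. rewrite h. ring. }
  rewrite H1 in H.
  replace (Kodd s) with ((zeta0 s * two_pow_neg s * (Kodd s + RtoC (ln 2))) / (zeta0 s * two_pow_neg s)
                         - RtoC (ln 2))%C by (field; auto).
  rewrite <- H, RtoC_opp. field. auto.
Qed.

(** * Almost extremal sequences *)

Definition F_abs (x : R) : R := gabs one_seq ln_odd3_half x.
Definition K_abs (x : R) : R := gabs K_coef K_freq x.

Lemma sin_lim_0_of_cos (a : nat -> R) (x : R) :
  x * x = 1 -> is_lim_seq (fun n => cos (a n)) x -> is_lim_seq (fun n => sin (a n)) 0.
Proof.
  intros Hx H. apply is_lim_seq_abs_0.
  apply (is_lim_seq_ext (fun n => sqrt (1 - cos (a n) * cos (a n)))).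
  { intro n. rewrite <- sqrt_Rsqr_abs. f_equal.
    assert (h := sin2_cos2 (a n)). unfold Rsqr in *. lra. }
  rewrite <- sqrt_0. apply (is_lim_seq_continuous sqrt _ 0); [apply continuity_pt_sqrt; lra|].
  replace 0 with (1 - x * x) by lra.
  apply is_lim_seq_minus'; [apply is_lim_seq_const | apply is_lim_seq_mult'; auto].
Qed.

(** Cosines with limits of modulus 1 have vanishing sines, so their limits multiply like characters.
    Alignment conditions can thus be multiplied and divided. *)
Lemma cos_lim_plus (a b : nat -> R) (x y : R) :
  x * x = 1 -> y * y = 1 ->
  is_lim_seq (fun n => cos (a n)) x -> is_lim_seq (fun n => cos (b n)) y ->
  is_lim_seq (fun n => cos (a n + b n)) (x * y).
Proof.
  intros Hx Hy Ha Hb.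
  apply (is_lim_seq_ext (fun n => cos (a n) * cos (b n) - sin (a n) * sin (b n))).
  { intro n. rewrite cos_plus. auto. }
  replace (x * y) with (x * y - 0 * 0) by ring.
  apply is_lim_seq_minus'; apply is_lim_seq_mult'; auto.
  - apply (sin_lim_0_of_cos a x); auto.
  - apply (sin_lim_0_of_cos b y); auto.
Qed.

Lemma cos_lim_minus (a b : nat -> R) (x y : R) :
  x * x = 1 -> y * y = 1 ->
  is_lim_seq (fun n => cos (a n)) x -> is_lim_seq (fun n => cos (b n)) y ->
  is_lim_seq (fun n => cos (a n - b n)) (x * y).
Proof.
  intros Hx Hy Ha Hb. apply (cos_lim_plus a (fun n => - b n)); auto.
  apply (is_lim_seq_ext (fun n => cos (b n))); auto. intro n. rewrite cos_neg; auto.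
Qed.

Lemma odd3_odd1 (j : nat) : odd3 j = odd1 (S j).
Proof. unfold odd3, odd1. lia. Qed.

Lemma F_aligned_of_zeta_aligned (t : nat -> R) :
  zeta_aligned t -> aligned one_seq ln_odd3_half t.
Proof.
  intros [H2 Hodd] j. unfold one_seq. rewrite Rabs_R1.
  apply (is_lim_seq_ext (fun n => cos (t n * ln (INR (S (2 * S j))) - t n * ln 2))).
  { intro n. rewrite Rmult_1_l. f_equal. unfold ln_odd3_half. rewrite odd3_odd1. unfold odd1. ring. }
  replace (Finite (- (1))) with (Finite (1 * -1)) by (f_equal; ring).
  apply cos_lim_minus; auto; lra.
Qed.

Lemma K_aligned_of_zeta_aligned (t : nat -> R) :
  zeta_aligned t -> aligned K_coef K_freq t.
Proof.
  intros Hal j. assert (HF := F_aligned_of_zeta_aligned t Hal). destruct Hal as [_ Hodd].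
  unfold K_coef, K_freq. assert (hm := mangoldt3_bounds (Nat.div2 j)).
  destruct (Nat.even j).
  - rewrite Rabs_pos_eq by lra.
    replace (- mangoldt3 (Nat.div2 j)) with (mangoldt3 (Nat.div2 j) * - (1)) by ring.
    apply (is_lim_seq_scal_l _ (mangoldt3 (Nat.div2 j)) (- (1))).
    specialize (HF (Nat.div2 j)). unfold one_seq in HF. rewrite Rabs_R1 in HF.
    eapply is_lim_seq_ext; [|exact HF]. intro n; cbv beta; ring.
  - rewrite Rabs_Ropp, Rabs_pos_eq by lra.
    replace (Finite (- mangoldt3 (Nat.div2 j))) with (Rbar_mult (- mangoldt3 (Nat.div2 j)) 1)
      by (simpl; f_equal; ring).
    apply (is_lim_seq_scal_l _ (- mangoldt3 (Nat.div2 j)) 1).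
    eapply is_lim_seq_ext; [|exact (Hodd (S (Nat.div2 j)))]. intro n; cbv beta.
    unfold ln_odd3. rewrite odd3_odd1. unfold odd1. f_equal. ring.
Qed.

(** Alignment controls only the ratios [m / 2]. The square 9 unlocks them: [3 = (9/2) / (3/2)] gives
    the limit 1 at 3, then [2 = 3 / (3/2)] gives [-1] at 2, and [m = (m/2) * 2] gives 1 at every odd
    [m]. *)
Lemma zeta_aligned_of_F_aligned (t : nat -> R) :
  aligned one_seq ln_odd3_half t -> zeta_aligned t.
Proof.
  intro H.
  assert (Hm : forall j, is_lim_seq (fun n => cos (t n * ln (INR (odd3 j)) - t n * ln 2)) (-1)).
  { intro j. specialize (H j). unfold one_seq in H. rewrite Rabs_R1 in H.
    replace (-1) with (- (1)) by lra.
    eapply is_lim_seq_ext; [|exact H]. intro n; cbv beta. unfold ln_odd3_half.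
    rewrite Rmult_1_l. f_equal. ring. }
  assert (L9 : ln (INR (odd3 3)) = 2 * ln (INR (odd3 0))).
  { change (odd3 3) with (odd3 0 * odd3 0)%nat. rewrite mult_INR, ln_mult by (apply lt_0_INR; unfold odd3; lia).
    ring. }
  assert (H3 : is_lim_seq (fun n => cos (t n * ln (INR (odd3 0)))) 1).
  { eapply is_lim_seq_ext; [|replace 1 with (-1 * -1) by lra;
      exact (cos_lim_minus _ _ (-1) (-1) ltac:(lra) ltac:(lra) (Hm 3%nat) (Hm 0%nat))].
    intro n; cbv beta. rewrite L9. f_equal. ring. }
  assert (H2 : is_lim_seq (fun n => cos (t n * ln 2)) (-1)).
  { eapply is_lim_seq_ext; [|replace (-1) with (1 * -1) by lra;
      exact (cos_lim_minus _ _ 1 (-1) ltac:(lra) ltac:(lra) H3 (Hm 0%nat))].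
    intro n; cbv beta. f_equal. ring. }
  split; auto. intro k. destruct k as [|k].
  - apply (is_lim_seq_ext (fun _ => 1)); [|apply is_lim_seq_const].
    intro n. change (INR (S (2 * 0))) with 1. rewrite ln_1, Rmult_0_r, cos_0. auto.
  - eapply is_lim_seq_ext; [|replace 1 with (-1 * -1) by lra;
      exact (cos_lim_plus _ _ (-1) (-1) ltac:(lra) ltac:(lra) (Hm k) H2)].
    intro n; cbv beta. rewrite odd3_odd1. unfold odd1. f_equal. ring.
Qed.

Lemma nprime_3 : nprime 3.
Proof.
  split; [lia|]. intros d Hd. assert (h := Nat.divide_pos_le d 3 ltac:(lia) Hd).
  destruct Hd as [x Hx]. destruct d as [|[|[|[|d]]]]; lia.
Qed.

Lemma nprime_5 : nprime 5.
Proof.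
  split; [lia|]. intros d Hd. assert (h := Nat.divide_pos_le d 5 ltac:(lia) Hd).
  destruct Hd as [x Hx]. destruct d as [|[|[|[|[|[|d]]]]]]; lia.
Qed.

Lemma mangoldt3_prime (j : nat) : nprime (odd3 j) -> mangoldt3 j = ln (INR (odd3 j)) /\ 0 < mangoldt3 j.
Proof.
  intro Hp. unfold mangoldt3. rewrite <- (Nat.pow_1_r (odd3 j)) at 1 3. rewrite !mangoldt_pow by auto.
  split; auto. rewrite <- ln_1. apply ln_increasing; [lra|]. apply (lt_INR 1). unfold odd3; lia.
Qed.

Lemma is_lim_seq_scal_cancel (u : nat -> R) (c l : R) :
  c <> 0 -> is_lim_seq (fun n => c * u n) (c * l) -> is_lim_seq u l.
Proof.
  intros Hc H. apply (is_lim_seq_ext (fun n => / c * (c * u n))); [intro n; field; auto|].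
  replace (Finite l) with (Rbar_mult (/ c) (c * l)) by (simpl; f_equal; field; auto).
  apply is_lim_seq_scal_l. exact H.
Qed.

(** Alignment is informative only where [mangoldt] is nonzero. At an odd prime [p] the two halves of
    [K] give the limits [-1] at [p / 2] and 1 at [p]; the prime 3 then settles 2, and factorization
    into primes settles the other odd integers. *)
Lemma zeta_aligned_of_K_aligned (t : nat -> R) :
  aligned K_coef K_freq t -> zeta_aligned t.
Proof.
  intro H.
  assert (Hp : forall j, nprime (odd3 j) ->
     is_lim_seq (fun n => cos (ln_odd3_half j * t n)) (-1) /\
     is_lim_seq (fun n => cos (ln_odd3 j * t n)) 1).
  { intros j Hj. destruct (mangoldt3_prime j Hj) as [_ Hpos].
    assert (He := H (2 * j)%nat). assert (Ho := H (S (2 * j))).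
    destruct (K_even j) as [E1 E2]. destruct (K_odd j) as [O1 O2].
    rewrite E1, E2 in He. rewrite O1, O2 in Ho.
    rewrite Rabs_Ropp in Ho. rewrite Rabs_pos_eq in He, Ho by lra.
    split.
    - apply (is_lim_seq_scal_cancel _ (mangoldt3 j)); [lra|].
      replace (mangoldt3 j * -1) with (- mangoldt3 j) by ring. exact He.
    - apply (is_lim_seq_scal_cancel _ (- mangoldt3 j)); [lra|].
      rewrite Rmult_1_r. exact Ho. }
  split.
  - destruct (Hp 0%nat nprime_3) as [H1 H2].
    eapply is_lim_seq_ext; [|replace (-1) with (1 * -1) by lra;
      exact (cos_lim_minus _ _ 1 (-1) ltac:(lra) ltac:(lra) H2 H1)].
    intro n; cbv beta. f_equal. unfold ln_odd3, ln_odd3_half. ring.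
  - assert (Hm : forall m, Nat.Odd m -> is_lim_seq (fun n => cos (t n * ln (INR m))) 1).
    { induction m as [m IH] using lt_wf_ind. intro Hodd.
      destruct (le_lt_dec m 1) as [Hm|Hm].
      - assert (m = 1)%nat as -> by (destruct Hodd; lia).
        apply (is_lim_seq_ext (fun _ => 1)); [|apply is_lim_seq_const].
        intro n. change (INR 1) with 1. rewrite ln_1, Rmult_0_r, cos_0. auto.
      - destruct (nprime_divisor m Hm) as [p [Hpr Hdiv]].
        assert (Hpo := odd_divisor p m Hodd Hdiv). destruct Hdiv as [q Hq].
        assert (Hp1 : (1 < p)%nat) by apply Hpr.
        assert (Hqo : Nat.Odd q) by (apply (odd_divisor q m Hodd); exists p; lia).
        destruct (odd_ge3 p Hpo Hp1) as [j ->].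
        assert (Hq0 : (0 < q)%nat) by (destruct Hqo; lia).
        eapply is_lim_seq_ext; [|replace 1 with (1 * 1) by lra;
          exact (cos_lim_plus _ _ 1 1 ltac:(lra) ltac:(lra) (IH q ltac:(nia) Hqo) (proj2 (Hp j Hpr)))].
        intro n; cbv beta. f_equal. unfold ln_odd3.
        rewrite Hq, mult_INR, ln_mult by (apply lt_0_INR; lia). ring. }
    intro k. apply Hm. exists k. lia.
Qed.

(** * Numerical estimates at the abscissas 2 and 101/100 *)

Lemma exp_neg_ln_mul2 (m : R) : 0 < m -> exp (- (ln m * 2)) = / (m * m).
Proof.
  intro Hm. replace (- (ln m * 2)) with (- ln m + - ln m) by ring.
  rewrite exp_plus, exp_Ropp, exp_ln by auto. field. lra.
Qed.

Lemma exp_half_mul2 (m : R) : 0 < m -> exp (- ((ln m - ln 2) * 2)) = 4 / (m * m).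
Proof.
  intro Hm. rewrite <- ln_div, exp_neg_ln_mul2 by lra. field. lra.
Qed.

(** Telescoping: [(2 / (2 j + 3))^2 = 1 / (j + 3/2)^2], and [(j + 3/2)^2] exceeds [(j + 1) (j + 2)]
    by [1/4]. *)
Lemma F_abs_2 : F_abs 2 <= 1.
Proof.
  unfold F_abs, gabs.
  apply (is_lim_seq_le (sum_n (fun j => Rabs (one_seq j) * exp (- (ln_odd3_half j * 2)))) (fun _ => 1)
           (Series (fun j => Rabs (one_seq j) * exp (- (ln_odd3_half j * 2)))) 1).
  - intro n.
    assert (Hle : sum_n (fun j => Rabs (one_seq j) * exp (- (ln_odd3_half j * 2))) n <= 1 - / (INR n + 2)).
    { assert (Ht : forall j, Rabs (one_seq j) * exp (- (ln_odd3_half j * 2)) <= / (INR j + 1) - / (INR j + 2)).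
      { intro j. unfold one_seq, ln_odd3_half. assert (h := pos_INR j).
        assert (E : INR (odd3 j) = 2 * INR j + 3).
        { unfold odd3. rewrite plus_INR, mult_INR. simpl. lra. }
        rewrite Rabs_R1, Rmult_1_l, E, exp_half_mul2 by lra.
        replace (/ (INR j + 1) - / (INR j + 2)) with (/ ((INR j + 1) * (INR j + 2))) by (field; lra).
        replace (4 / ((2 * INR j + 3) * (2 * INR j + 3)))
          with (/ ((INR j + 3 / 2) * (INR j + 3 / 2))) by (field; lra).
        apply Rinv_le_contravar; nra. }
      induction n as [|n IH].
      - rewrite sum_O. eapply Rle_trans; [apply Ht|]. simpl. lra.
      - rewrite sum_Sn. unfold plus; simpl plus. specialize (Ht (S n)).
        rewrite S_INR in Ht |- *. replace (INR n + 1 + 1) with (INR n + 2) in Ht by ring.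
        simpl. lra. }
    eapply Rle_trans; [exact Hle|].
    assert (h := pos_INR n). assert (0 < / (INR n + 2)) by (apply Rinv_0_lt_compat; lra). lra.
  - apply (Series_correct (fun j => Rabs (one_seq j) * exp (- (ln_odd3_half j * 2)))).
    apply (gdir_conv _ _ ok_odd3_half). lra.
  - apply is_lim_seq_const.
Qed.

(** At a zero [2^-s F s = -1], but [2^-s] has modulus below 1 and [F s] has modulus at most
    [F_abs 2 <= 1]. *)
Lemma zeta0_neq_0 (s : C) : 2 <= Re s -> zeta0 s <> RtoC 0.
Proof.
  intros Hs h. assert (Hs1 : 1 < Re s) by lra.
  assert (H := zeta0_F s Hs1). rewrite h in H.
  assert (Hm : Cmod (two_pow_neg s * Fodd s)%C = 1).
  { replace (two_pow_neg s * Fodd s)%C with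
      ((RtoC 1 + two_pow_neg s * Fodd s) - RtoC 1)%C by ring.
    rewrite <- H. replace (_ - _)%C with (- RtoC 1)%C by ring. rewrite Cmod_opp, Cmod_1. auto. }
  rewrite Cmod_mult in Hm.
  assert (h1 := two_pow_neg_lt_1 s Hs1).
  assert (h2 : Cmod (Fodd s) <= 1).
  { eapply Rle_trans; [apply (Cmod_gdir_le _ _ ok_odd3_half); auto|].
    eapply Rle_trans; [|apply F_abs_2]. replace (Re s) with (2 + (Re s - 2)) by ring.
    eapply Rle_trans; [apply (gabs_decay _ _ 0); try lra; [apply ok_odd3_half | apply (gdir_lam_pos _ _ ok_odd3_half)]|].
    rewrite Rmult_0_l, Ropp_0, exp_0, Rmult_1_l. apply Rle_refl. }
  assert (h3 := Cmod_ge_0 (Fodd s)). assert (h4 := Cmod_ge_0 (two_pow_neg s)). nra.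
Qed.

(** This places [E] beyond 2. The first three terms suffice: they are
    [(4/9 + 1/9) ln 3 + (4/25) ln 5], and the comparisons [8 < 9] and [4 < 5] bound this below by
    [(5/6 + 8/25) ln 2]. *)
Lemma K_abs_2 : ln 2 < K_abs 2.
Proof.
  assert (h2 := ln2_pos).
  apply Rlt_le_trans with (sum_n (fun j => Rabs (K_coef j) * exp (- (K_freq j * 2))) 2).
  - rewrite !sum_Sn, sum_O. unfold plus; simpl plus.
    destruct (K_even 0 : K_coef 0 = mangoldt3 0 /\ K_freq 0 = ln_odd3_half 0) as [-> ->].
    destruct (K_odd 0 : K_coef 1 = - mangoldt3 0 /\ K_freq 1 = ln_odd3 0) as [-> ->].
    destruct (K_even 1 : K_coef 2 = mangoldt3 1 /\ K_freq 2 = ln_odd3_half 1) as [-> ->].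
    destruct (mangoldt3_prime 0 nprime_3) as [E3 P3]. destruct (mangoldt3_prime 1 nprime_5) as [E5 P5].
    unfold ln_odd3_half, ln_odd3. rewrite Rabs_Ropp, !Rabs_pos_eq, E3, E5 by lra.
    replace (INR (odd3 0)) with 3 by (simpl; lra). replace (INR (odd3 1)) with 5 by (simpl; lra).
    rewrite !exp_half_mul2, exp_neg_ln_mul2 by lra.
    assert (H3 : 3 * ln 2 <= 2 * ln 3).
    { replace (3 * ln 2) with (ln 8). replace (2 * ln 3) with (ln 9).
      - left. apply ln_increasing; lra.
      - replace 9 with (3 * 3) by lra. rewrite ln_mult by lra. ring.
      - replace 8 with (2 * (2 * 2)) by lra. rewrite !ln_mult by lra. ring. }
    assert (H5 : 2 * ln 2 <= ln 5).
    { replace (2 * ln 2) with (ln 4).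
      - left. apply ln_increasing; lra.
      - replace 4 with (2 * 2) by lra. rewrite ln_mult by lra. ring. }
    simpl. lra.
  - apply sum_n_le_series.
    + intro k. apply Rmult_le_pos; [apply Rabs_pos | left; apply exp_pos].
    + apply Series_correct. apply (gdir_conv _ _ ok_K). lra.
Qed.

Lemma ln_le_minus_1 (x : R) : 0 < x -> ln x <= x - 1.
Proof. intro Hx. assert (h := exp_ineq1_le (ln x)). rewrite exp_ln in h by auto. lra. Qed.

(** At abscissa 1 the terms [m = 3] and [m = 5] already add up to [2/3 + 2/5 = 16/15]. The margin
    allows a move to [101/100], inside the region of convergence. *)
Lemma F_abs_large : 1 < F_abs (101 / 100).
Proof.
  apply Rlt_le_trans with (sum_n (fun j => Rabs (one_seq j) * exp (- (ln_odd3_half j * (101 / 100)))) 1).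
  - rewrite sum_Sn, sum_O. unfold plus; simpl plus. unfold one_seq, ln_odd3_half. rewrite Rabs_R1.
    replace (INR (odd3 0)) with 3 by (simpl; lra). replace (INR (odd3 1)) with 5 by (simpl; lra).
    assert (H : forall m, 0 < m -> / m * (1 - (m - 1) / 100) <= exp (- (ln m * (101 / 100)))).
    { intros m Hm. replace (- (ln m * (101 / 100))) with (- ln m + - (ln m / 100)) by field.
      rewrite exp_plus, exp_Ropp, exp_ln by auto.
      apply Rmult_le_compat_l; [left; apply Rinv_0_lt_compat; auto|].
      assert (h := exp_ineq1_le (- (ln m / 100))). assert (h' := ln_le_minus_1 m Hm). lra. }
    rewrite <- !ln_div by lra.
    assert (h1 := H (3 / 2) ltac:(lra)). assert (h2 := H (5 / 2) ltac:(lra)).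
    replace (/ (3 / 2)) with (2 / 3) in h1 by field. replace (/ (5 / 2)) with (2 / 5) in h2 by field.
    simpl. lra.
  - apply sum_n_le_series.
    + intro k. apply Rmult_le_pos; [apply Rabs_pos | left; apply exp_pos].
    + apply Series_correct. apply (gdir_conv _ _ ok_odd3_half). lra.
Qed.

(** * The two extremal abscissas *)

Lemma gdir_real (b lam : nat -> R) (x : R) :
  (forall j, 0 <= b j) -> gdir b lam (RtoC x) = RtoC (gabs b lam x).
Proof.
  intro Hb. unfold gdir, CSeries, gabs, RtoC. f_equal.
  - apply Series_ext. intro j. rewrite Re_gterm, Rmult_0_r, cos_0, Rmult_1_r, Rabs_pos_eq; auto.
  - rewrite (Series_ext _ (fun _ => 0 * 0)).
    + rewrite Series_scal_l. ring.
    + intro j. rewrite Im_gterm, Rmult_0_r, sin_0. ring.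
Qed.

(** Taking moduli turns the factor [2^x - 1] of [K] into [2^x + 1]. *)
Lemma K_abs_mangoldt (x : R) : 1 < x ->
  K_abs x = gabs mangoldt3 ln_odd3 x * (exp (ln 2 * x) + 1).
Proof.
  intro Hx. unfold K_abs, gabs.
  assert (HK := is_series_pairs _ _ (Series_correct _ (gdir_conv _ _ ok_K x Hx))).
  rewrite <- (is_series_unique _ _ HK), <- Series_scal_r. apply Series_ext. intro m.
  destruct (K_even m) as [-> ->]. destruct (K_odd m) as [-> ->]. rewrite Rabs_Ropp.
  replace (- (ln_odd3_half m * x)) with (- (ln_odd3 m * x) + ln 2 * x)
    by (unfold ln_odd3_half, ln_odd3; ring).
  rewrite exp_plus. ring.
Qed.

(** With [u = 2^x] and [L] the value of [Lodd] at [x], the right side is [L + ln 2 / (u - 1)] and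
    the left side splits into [ln 2 / (u + 1) + ln 2 / (u - 1)]. The equation thus reduces to
    [L (u + 1) = ln 2]. *)
Lemma E_equation_iff (x : R) : E_equation x <-> 1 < x /\ K_abs x = ln 2.
Proof.
  unfold E_equation. split; intros [Hx H]; split; auto; revert H.
  all: assert (Hs : 1 < Re (RtoC x)) by exact Hx.
  all: rewrite (is_C_derive_unique _ _ _ (zeta_derive _ Hs)), zeta_zeta0, K_abs_mangoldt by auto.
  all: assert (H1 := zeta1_L _ Hs).
  all: set (L := gabs mangoldt3 ln_odd3 x).
  all: assert (HL : Lodd (RtoC x) = RtoC L)
    by (apply gdir_real; intro; apply mangoldt3_bounds).
  all: assert (Hw : two_pow_neg (RtoC x) = RtoC (exp (- (ln 2 * x))))
    by (unfold two_pow_neg, Cexp, RtoC, Re, Im; simpl;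
        replace (- (ln 2 * 0 + 0 * x)) with 0 by ring; rewrite cos_0, sin_0;
        replace (- (ln 2 * x - 0 * 0)) with (- (ln 2 * x)) by ring; f_equal; ring).
  all: set (u := exp (ln 2 * x)).
  all: assert (Hu : 1 < u) by (unfold u; rewrite <- exp_0; apply exp_increasing;
                               assert (h := ln2_pos); nra).
  all: assert (Hwu : exp (- (ln 2 * x)) = / u) by (unfold u; apply exp_Ropp).
  all: rewrite HL, Hw, Hwu in H1.
  all: assert (Hz : zeta0 (RtoC x) <> RtoC 0)
    by (unfold zeta0; rewrite gdir_real by (intro; unfold one_seq; lra);
        intro h; apply RtoC_inj in h;
        assert (h' := term_le_series (fun j => Rabs (one_seq j) * exp (- (lnS j * x))) _ 0
           (fun k => Rmult_le_pos _ _ (Rabs_pos _) (Rlt_le _ _ (exp_pos _)))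
           (Series_correct _ (gdir_conv _ _ ok_zeta x Hx)));
        fold (gabs one_seq lnS x) in h'; rewrite h in h'; unfold one_seq in h'; rewrite Rabs_R1, Rmult_1_l in h';
        assert (hp := exp_pos (- (lnS 0 * x))); lra).
  all: assert (Hq : (- (- zeta1 (RtoC x) / zeta0 (RtoC x)))%C = RtoC (L + ln 2 / (u - 1))).
  1,3: assert (Hne : RtoC (1 - / u) <> RtoC 0)
      by (intro h; apply RtoC_inj in h;
          assert (/ u < 1) by (rewrite <- Rinv_1; apply Rinv_lt_contravar; lra); lra).
  1,2: rewrite <- RtoC_minus in H1;
       replace (- (- zeta1 (RtoC x) / zeta0 (RtoC x)))%C with
         ((RtoC (1 - / u) * zeta1 (RtoC x)) / (RtoC (1 - / u) * zeta0 (RtoC x)))%C by (field; auto);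
       rewrite H1;
       replace (_ / _)%C with ((RtoC (1 - / u) * RtoC L + RtoC (/ u) * RtoC (ln 2)) / RtoC (1 - / u))%C
         by (field; auto);
       rewrite <- !RtoC_mult, <- RtoC_plus, <- RtoC_div by (intro h; apply Hne; rewrite h; auto);
       f_equal; field; split; lra.
  all: rewrite Hq.
  all: assert (E1 : Rpower 2 (x + 1) = 2 * u)
    by (rewrite Rpower_plus, Rpower_1 by lra; unfold Rpower, u; rewrite (Rmult_comm x); ring).
  all: assert (E2 : Rpower 4 x = u * u)
    by (replace 4 with (2 * 2) by lra; unfold Rpower, u; rewrite ln_mult by lra;
        rewrite <- exp_plus; f_equal; ring).
  all: rewrite E1, E2.
  all: assert (E3 : 2 * u / (u * u - 1) * ln 2 = ln 2 / (u + 1) + ln 2 / (u - 1)) by (field; nra).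
  all: rewrite E3.
  - intro h. apply RtoC_inj in h. replace L with (ln 2 / (u + 1)) by lra. field. lra.
  - intro h. f_equal. replace (ln 2) with (L * (u + 1)) at 1 by exact h. field. lra.
Qed.

(** [epsilon] returns an unspecified solution, so the bound is proved for any solution: [K_abs]
    decreases strictly and still exceeds [ln 2] at 2. *)
Lemma E_zeta_spec : 2 < E_zeta /\ K_abs E_zeta = ln 2.
Proof.
  assert (Hex : exists x, E_equation x).
  { destruct (gabs_solution _ _ (ln (3 / 2)) 2 (ln 2) ok_K ln_3_2_pos K_freq_ge) as [y [Hy1 Hy2]];
      try lra; [apply ln2_pos | apply K_abs_2|].
    exists y. apply E_equation_iff. split; [lra | exact Hy2]. }
  assert (H := epsilon_spec (inhabits 0) E_equation Hex). fold E_zeta in H.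
  apply E_equation_iff in H. destruct H as [H1 H2]. split; auto.
  apply Rnot_le_lt. intro h. assert (h2 := K_abs_2). assert (h3 := ln2_pos).
  destruct h as [h|h]; [|rewrite h in H2; lra].
  assert (K_abs 2 < K_abs E_zeta); [|lra].
  apply (gabs_strict_decr _ _ (ln (3 / 2))); auto using ok_K, ln_3_2_pos, K_freq_ge.
  fold (K_abs E_zeta). lra.
Qed.

Lemma eventually_gt (u : nat -> R) (l c : R) :
  is_lim_seq u l -> c < l -> exists N, forall n, (N <= n)%nat -> c < u n.
Proof.
  intros H Hc.
  destruct (proj2 (is_lim_seq_spec _ _) H (mkposreal (l - c) ltac:(lra))) as [N HN].
  cbn [pos] in HN. exists N. intros n Hn. specialize (HN n Hn). apply Rabs_lt_between in HN. lra.
Qed.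

Lemma Re_lim_of_Cmod (z : nat -> C) (x : R) :
  is_lim_seq (fun n => Cmod (z n - RtoC x)%C) 0 -> is_lim_seq (fun n => Re (z n)) x.
Proof.
  intro H. apply is_lim_seq_minus_0. eapply is_lim_seq_squeeze_0; [|exact H].
  intro n. exact (Re_le_Cmod (z n - RtoC x)%C).
Qed.

(** Upper bound: [Fodd = -1] forces [F_abs >= 1], and [F_abs] decreases strictly. A competitor lies
    to the right of [y > 1], where zeta is given by its Dirichlet series. Lower bound: Newton's
    method at aligned heights yields solutions with real parts tending to [y]. *)
Lemma sigma_one_spec : 1 < sigma_one /\ F_abs sigma_one = 1.
Proof.
  destruct (gabs_solution _ _ (ln (3 / 2)) (101 / 100) 1 ok_odd3_half ln_3_2_pos ln_odd3_half_ge)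
    as [y [Hy1 Hy2]]; try lra; [apply F_abs_large|].
  assert (Hy : 1 < y) by lra.
  assert (Hlub : is_lub_Rbar (fun sigma => exists t : R, zeta (sigma, t) = RtoC 1) y).
  { split.
    - intros x [t Ht]. simpl. apply Rnot_lt_le. intro Hxy.
      assert (Hs : 1 < Re (x, t)) by (unfold Re; simpl; lra).
      apply (zeta_one_iff _ Hs) in Ht.
      assert (h := Cmod_gdir_le _ _ ok_odd3_half _ Hs). fold (Fodd (x, t)) in h.
      rewrite Ht, Cmod_R, Rabs_Ropp, Rabs_R1 in h.
      assert (h' := gabs_strict_decr _ _ (ln (3 / 2)) y x ok_odd3_half ln_3_2_pos ln_odd3_half_ge Hy Hxy).
      unfold Re in h; simpl in h. rewrite Hy2 in h'. specialize (h' ltac:(lra)). lra.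
    - intros B HB. destruct zeta_aligned_exists as [t Ht].
      destruct (solutions_of_aligned _ _ t (ln (3 / 2)) y 1 ok_odd3_half ln_3_2_pos ln_odd3_half_ge Hy
                  ltac:(lra) Hy2 (F_aligned_of_zeta_aligned t Ht)) as [z [N [Hz Hl]]].
      apply Re_lim_of_Cmod in Hl.
      destruct (eventually_gt _ _ _ Hl Hy) as [N' HN'].
      assert (HzB : forall n, (max N N' <= n)%nat -> Rbar_le (Re (z n)) B).
      { intros n Hn. apply HB. exists (Im (z n + (0, t n))%C).
        assert (E : (Re (z n), Im (z n + (0, t n))%C) = (z n + (0, t n))%C).
        { destruct (z n); unfold Re, Im, Cplus; simpl. f_equal; ring. }
        rewrite E. apply zeta_one_iff.
        - rewrite <- E. apply HN'. lia.
        - apply Hz. lia. }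
      destruct B as [B| |]; simpl; auto.
      + apply (is_lim_seq_le_loc (fun n => Re (z n)) (fun _ => B) y B).
        * exists (max N N'). apply HzB.
        * exact Hl.
        * apply is_lim_seq_const.
      + apply (HzB (max N N')). lia. }
  unfold sigma_one. rewrite (is_lub_Rbar_unique _ _ Hlub). simpl. auto.
Qed.

(** * Transfer between the two kinds of sequences *)

Lemma is_lim_Cseq_of_Cmod (u : nat -> C) (l : C) :
  is_lim_seq (fun n => Cmod (u n - l)%C) 0 -> is_lim_Cseq u l.
Proof.
  intros H P [eps HP].
  destruct (proj2 (is_lim_seq_spec _ _) H eps) as [N HN].
  exists N. intros n Hn. apply HP. specialize (HN n Hn). rewrite Rminus_0_r in HN.
  rewrite Rabs_pos_eq in HN by apply Cmod_ge_0.
  split.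
  - change (Rabs (Re (u n - l)%C) < eps). eapply Rle_lt_trans; [apply Re_le_Cmod | exact HN].
  - change (Rabs (Im (u n - l)%C) < eps). eapply Rle_lt_trans; [apply Im_le_Cmod | exact HN].
Qed.

Lemma is_lim_seq_max (u : nat -> R) (l : Rbar) (N : nat) :
  is_lim_seq u l -> is_lim_seq (fun n => u (max n N)) l.
Proof.
  apply is_lim_seq_ext_loc. exists N. intros n Hn. rewrite Nat.max_l by lia. auto.
Qed.

(** The new points have the same imaginary parts as [s n], up to the error in [z n], and their real
    parts tend to [x]. Since [P] is known only from [N] on, the earlier terms repeat the one at
    [N]. *)
Lemma companion_sequence (P : C -> Prop) (s z : nat -> C) (x y : R) (N : nat) :
  (forall n, (N <= n)%nat -> P (z n + (0, Im (s n)))%C) ->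
  is_lim_seq (fun n => Cmod (z n - RtoC x)%C) 0 ->
  is_lim_seq (fun n => Re (s n)) y ->
  exists rho : nat -> C, (forall n, P (rho n)) /\ is_lim_seq (fun n => Re (rho n)) x /\
    is_lim_seq (fun n => Cmod (rho n - s n - RtoC (x - y))%C) 0.
Proof.
  intros HP Hz Hs.
  exists (fun n => z (max n N) + (0, Im (s (max n N))))%C. repeat split.
  - intro n. apply HP. lia.
  - apply (is_lim_seq_max (fun n => Re (z n + (0, Im (s n)))%C)).
    apply (is_lim_seq_ext (fun n => Re (z n))).
    + intro n. unfold Re, Cplus; simpl. ring.
    + apply Re_lim_of_Cmod; auto.
  - apply (is_lim_seq_ext_loc (fun n => Cmod ((z n - RtoC x) - RtoC (Re (s n) - y))%C)).
    + exists N. intros n Hn. rewrite Nat.max_l by lia. f_equal.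
      destruct (z n), (s n); apply injective_projections; simpl; ring.
    + apply (is_lim_seq_squeeze_0 _ (fun n => Cmod (z n - RtoC x)%C + Rabs (Re (s n) - y))).
      * intro n. rewrite Rabs_pos_eq by apply Cmod_ge_0. unfold Cminus at 1.
        eapply Rle_trans; [apply Cmod_triangle|]. rewrite Cmod_opp, Cmod_R. lra.
      * replace (Finite 0) with (Finite (0 + 0)) by (f_equal; ring).
        apply is_lim_seq_plus'; auto. apply -> is_lim_seq_abs_0. apply is_lim_seq_minus_0; auto.
Qed.

Theorem theorem6p2 :
  (forall s : nat -> C, almost_extremal_zeta_one s ->
     exists rho : nat -> C, almost_extremal_zeta'_zero rho /\
       is_lim_Cseq (fun n => rho n - s n)%C (RtoC (E_zeta - sigma_one))) /\
  (forall rho : nat -> C, almost_extremal_zeta'_zero rho ->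
     exists s : nat -> C, almost_extremal_zeta_one s /\
       is_lim_Cseq (fun n => rho n - s n)%C (RtoC (E_zeta - sigma_one))).
Proof.
  destruct sigma_one_spec as [S1 S2]. destruct E_zeta_spec as [E1 E2].
  assert (E3 : 1 < E_zeta) by lra. assert (H2 := ln2_pos).
  split.
  - intros s [Hs1 Hs2].
    destruct (eventually_gt _ _ _ Hs2 S1) as [N HN].
    (* The reindexing discards the terms with [Re (s n) <= 1], as alignment is derived for sequences
       lying entirely in the half-plane of convergence. *)
    assert (Hal : zeta_aligned (fun n => Im (s (max n N)))).
    { apply zeta_aligned_of_F_aligned.
      apply (aligned_of_solutions _ _ (fun n => s (max n N)) sigma_one 1); auto using ok_odd3_half.
      - intro n. apply HN. lia.
      - intro n. apply zeta_one_iff; auto. apply HN. lia.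
      - apply (is_lim_seq_max (fun n => Re (s n))); auto. }
    destruct (solutions_of_aligned _ _ _ (ln (3 / 2)) E_zeta (ln 2) ok_K ln_3_2_pos K_freq_ge E3 H2 E2
                (K_aligned_of_zeta_aligned _ Hal)) as [z [N1 [Hz Hl]]].
    destruct (eventually_gt _ _ _ (Re_lim_of_Cmod _ _ Hl) E3) as [N2 HN2].
    destruct (companion_sequence
      (fun w => is_derive (K := C_AbsRing) (V := C_NormedModule) zeta w (RtoC 0))
      s z E_zeta sigma_one (max N (max N1 N2))) as [rho [R1 [R2 R3]]]; auto.
    + intros n Hn. specialize (Hz n ltac:(lia)). cbv beta in Hz. rewrite Nat.max_l in Hz by lia.
      apply zeta'_zero_of_K; auto.
      replace (Re (z n + (0, Im (s n)))%C) with (Re (z n)) by (unfold Re, Cplus; simpl; ring).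
      apply HN2. lia.
    + exists rho. split; [split; auto|]. apply is_lim_Cseq_of_Cmod. exact R3.
  - intros rho [Hr1 Hr2].
    destruct (eventually_gt _ _ _ Hr2 E1) as [N HN].
    assert (Hal : zeta_aligned (fun n => Im (rho (max n N)))).
    { apply zeta_aligned_of_K_aligned.
      (* Real parts beyond 2 make zeta nonzero at these points, so that [zeta' = 0] can be rewritten
         as [K = - ln 2]. *)
      assert (HN' : forall n, 2 < Re (rho (max n N))) by (intro n; apply HN; lia).
      apply (aligned_of_solutions _ _ (fun n => rho (max n N)) E_zeta (ln 2)); auto using ok_K.
      - intro n. specialize (HN' n). lra.
      - intro n. specialize (HN' n). apply K_of_zeta'_zero; [lra | apply zeta0_neq_0; lra | apply Hr1].
      - apply (is_lim_seq_max (fun n => Re (rho n))); auto. }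
    destruct (solutions_of_aligned _ _ _ (ln (3 / 2)) sigma_one 1 ok_odd3_half ln_3_2_pos ln_odd3_half_ge S1
                ltac:(lra) S2 (F_aligned_of_zeta_aligned _ Hal)) as [z [N1 [Hz Hl]]].
    destruct (eventually_gt _ _ _ (Re_lim_of_Cmod _ _ Hl) S1) as [N2 HN2].
    destruct (companion_sequence (fun w => zeta w = RtoC 1)
      rho z sigma_one E_zeta (max N (max N1 N2))) as [s [R1 [R2 R3]]]; auto.
    + intros n Hn. specialize (Hz n ltac:(lia)). cbv beta in Hz. rewrite Nat.max_l in Hz by lia.
      apply zeta_one_iff; auto.
      replace (Re (z n + (0, Im (rho n)))%C) with (Re (z n)) by (unfold Re, Cplus; simpl; ring).
      apply HN2. lia.
    + exists s. split; [split; auto|]. apply is_lim_Cseq_of_Cmod.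
      (* The companion estimate concerns [s n - rho n] and [sigma_one - E_zeta]; the modulus is
         unchanged by the change of sign. *)
      eapply is_lim_seq_ext; [|exact R3]. intro n; cbv beta.
      rewrite <- Cmod_opp. f_equal. rewrite !RtoC_minus. ring.
Qed.
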